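(* A sequence $(P_n)_{n\geq 1}$ of probability measures on $\big(\mathbb{D}([0,1];\mathbb{D}),\mathcal{D}_{\mathbb{D}}\big)$ is tight if and only if it satisfies the following three conditions: (i) $\displaystyle\lim_{a \to \infty} \limsup_{n\to \infty} P_n\big(\{x:\ \|x\|_{\mathbb{D}} \geq a\}\big)=0$; (ii) for any $\varepsilon>0$, $\displaystyle\lim_{\delta \to 0}\limsup_{n\to \infty}P_n\big(\{x:\ w'(x(t),\delta) \geq \varepsilon \text{ for some } t \in [0,1]\}\big)=0$; (iii) for any $\varepsilon>0$, $\displaystyle\lim_{\delta \to 0}\limsup_{n\to \infty}P_n\big(\{x:\ w_{\mathbb{D}}'(x,\delta) \geq \varepsilon \}\big)=0$.
   Context: $\mathbb{D}$ is the set of functions $x:[0,1]\to\mathbb{R}$ that are right-continuous and have left limits, with $\|x\|=\sup_{s\in[0,1]}|x(s)|$. $\Lambda$ is the set of strictly increasing continuous functions from $[0,1]$ onto $[0,1]$, $e$ is the identity on $[0,1]$, and for $\lambda\in\Lambda$, $\|\lambda\|^0=\sup_{s<s'}\left|\log\frac{\lambda(s')-\lambda(s)}{s'-s}\right|$. The Skorohod $J_1$-topology on $\mathbb{D}$ is given by the (complete, separable) metric $d_{J_1}^0(x,y)=\inf_{\lambda\in\Lambda}\{\|\lambda\|^0\vee\|x-y\circ\lambda\|\}$. $\mathbb{D}([0,1];\mathbb{D})$ is the set of functions $x:[0,1]\to\mathbb{D}$ that are right-continuous at every $t\in[0,1)$ and have a left limit $x(t-)\in\mathbb{D}$ at every $t\in(0,1]$,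 both with respect to $d_{J_1}^0$. Put $\|x\|_{\mathbb{D}}=\sup_{t\in[0,1]}\|x(t)\|$. It is equipped with the metric $d_{\mathbb{D}}(x,y)=\inf_{\lambda\in\Lambda}\{\|\lambda-e\|\vee\rho_{\mathbb{D}}(x,y\circ\lambda)\}$, where $\rho_{\mathbb{D}}(x,y)=\sup_{t\in[0,1]}d_{J_1}^0(x(t),y(t))$, and with its Borel $\sigma$-field $\mathcal{D}_{\mathbb{D}}$ for $d_{\mathbb{D}}$. A set $\{t_i\}_{0\le i\le v}$ with $0=t_0<t_1<\dots<t_v=1$ is $\delta$-sparse if $\min_{1\le i\le v}(t_i-t_{i-1})>\delta$. For $\delta\in(0,1)$: for $x\in\mathbb{D}$, $w'(x,\delta)=\inf_{\{t_i\}}\max_{1\le i\le v}\ \sup_{s_1,s_2\in[t_{i-1},t_i)}|x(s_1)-x(s_2)|$; for $x\in\mathbb{D}([0,1];\mathbb{D})$, $w'_{\mathbb{D}}(x,\delta)=\inf_{\{t_i\}}\max_{1\le i\le v}\ \sup_{r_1,r_2\in[t_{i-1},t_i)}d_{J_1}^0(x(r_1),x(r_2))$; both infima being over all $\delta$-sparse sets. A family of probability measures on $(\mathbb{D}([0,1];\mathbb{D}),\mathcal{D}_{\mathbb{D}})$ is tight if for every $\eta>0$ there is a $d_{\mathbb{D}}$-compact set $K$ with $P(K)\ge 1-\eta$ for every $P$ in the family. *)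

(* Defs.v *)
From HB Require Import structures.
From mathcomp Require Import all_boot all_order all_algebra.
From mathcomp Require Import all_classical all_reals all_analysis.

Set Implicit Arguments.
Unset Strict Implicit.
Unset Printing Implicit Defensive.

Import Order.TTheory GRing.Theory Num.Theory.
Import numFieldNormedType.Exports.

Local Open Scope classical_set_scope.
Local Open Scope ring_scope.

(* The topology is the one induced by [R] (library instance on [set_type]). *)
Notation unitI R := (@set_type R (`[(0 : R)%R, (1 : R)%R]%classic)).

Definition right_cont (R : realType) (T : topologicalType) (x : unitI R -> T) :=
  forall t : unitI R, val t < 1 ->
    x s @[s --> within [set s | val t < val s] (nbhs t)] --> x t.

Definition left_limits (R : realType) (T : topologicalType)
    (x : unitI R -> T) :=
  forall t : unitI R, 0 < val t -> exists l : T,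
    x s @[s --> within [set s | val s < val t] (nbhs t)] --> l.

Definition Lambda (R : realType) : set (unitI R -> unitI R) :=
  [set lam : unitI R -> unitI R |
    [/\ (forall s s' : unitI R, val s < val s' -> val (lam s) < val (lam s')),
        continuous lam
      & set_surj setT setT lam]].

Definition lognorm (R : realType) (lam : unitI R -> unitI R) : \bar R :=
  ereal_sup [set `|ln ((val (lam p.2) - val (lam p.1))
                       / (val p.2 - val p.1))|%:E
            | p in [set p : unitI R * unitI R | val p.1 < val p.2]].

Definition unifnorm (R : realType) (lam : unitI R -> unitI R) : \bar R :=
  ereal_sup (range (fun t => `|val (lam t) - val t|%:E)).

(* Common shape of the distances on D and on D([0,1]; D). Distances are
   extended-real valued, because [sup] is junk on unbounded sets of reals and
   [lognorm] can be infinite. *)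
Definition skorokhod (R : realType) (T : Type)
    (gauge : (unitI R -> unitI R) -> \bar R) (d : T -> T -> \bar R)
    (x y : unitI R -> T) : \bar R :=
  ereal_inf [set maxe (gauge lam)
                      (ereal_sup (range (fun t => d (x t) (y (lam t)))))
            | lam in @Lambda R].

Section skorokhod_pseudometric.
Context {R : realType}.
Notation U := (unitI R).

Lemma unitI_bounds (t : U) : 0 <= val t <= 1.
Proof. by have := set_valP t; rewrite /= in_itv. Qed.

Lemma unitI_mk (r : R) : 0 <= r <= 1 -> exists t : U, val t = r.
Proof.
move=> r01; have h : r \in (`[0 : R, 1]%classic) by rewrite inE /= in_itv.
by exists (exist _ r h).
Qed.

Lemma unitI_near (t : U) (P : U -> Prop) (e : R) : 0 < e ->
  (forall u : U, `|val t - val u| < e -> P u) -> \forall u \near t, P u.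
Proof.
by move=> e0 h; apply/nbhs_ballP; exists e => //= u ?; exact: h.
Qed.

Definition incr (f : U -> U) :=
  forall s s' : U, val s < val s' -> val (f s) < val (f s').

Lemma incr_inv f : incr f -> forall s s', val (f s) < val (f s') ->
  val s < val s'.
Proof.
move=> fi s s' h; rewrite ltNge; apply/negP; rewrite le_eqVlt => /orP[/eqP e|/fi].
  by move: h; rewrite (_ : s' = s) ?ltxx//; apply/val_inj.
by rewrite ltNge (ltW h).
Qed.

Lemma incr_inj f : incr f -> injective f.
Proof.
move=> fi s s' e; apply/val_inj/eqP; rewrite eq_le !leNgt.
by apply/andP; split; apply/negP => /fi; rewrite e ltxx.
Qed.

Lemma incr_surj_continuous f : incr f -> set_surj setT setT f -> continuous f.
Proof.
move=> fi fs s A /nbhs_ballP[e /= e0 sA].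
have /andP[fs0 fs1] := unitI_bounds (f s).
have up : \forall u \near s, val (f u) < val (f s) + e.
  have [h|h] := ltP 1 (val (f s) + e).
    apply: (@filterE _ (nbhs s) (nbhs_filter s)) => u; apply: le_lt_trans h.
    by have /andP[] := unitI_bounds (f u).
  have [|q qE] := @unitI_mk (val (f s) + e).
    by rewrite h addr_ge0// ltW.
  have [r _ rq] := fs q I; subst q.
  have sr : val s < val r by apply: (incr_inv fi); rewrite qE ltrDl.
  apply: (@unitI_near _ _ (val r - val s)); rewrite ?subr_gt0// => u su.
  rewrite -qE; apply: fi; rewrite distrC in su.
  by have := le_lt_trans (ler_norm _) su; rewrite ltrD2r.
have dn : \forall u \near s, val (f s) - e < val (f u).
  have [h|h] := ltP (val (f s) - e) 0.
    apply: (@filterE _ (nbhs s) (nbhs_filter s)) => u.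
    apply: lt_le_trans h _.
    by have /andP[] := unitI_bounds (f u).
  have [|q qE] := @unitI_mk (val (f s) - e).
    by rewrite h/= (le_trans _ fs1)// gerBl ltW.
  have [r _ rq] := fs q I; subst q.
  have sr : val r < val s by apply: (incr_inv fi); rewrite qE gtrBl.
  apply: (@unitI_near _ _ (val s - val r)); rewrite ?subr_gt0// => u su.
  rewrite -qE; apply: fi.
  have := le_lt_trans (ler_norm _) su.
  by rewrite ltrD2l ltrN2.
apply: (@filterS _ (nbhs s) (nbhs_filter s) _ _ _
  (@filterI _ (nbhs s) (nbhs_filter s) _ _ up dn)) => u [/= u1 u2].
apply: sA; have : `|val (f s) - val (f u)| < e by rewrite ltr_distlC u1 u2.
exact.
Qed.

Lemma Lambda_id : Lambda (@id U).
Proof. by split => //; move=> t A. Qed.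

Lemma Lambda_comp f g : Lambda f -> Lambda g -> Lambda (g \o f : U -> U).
Proof.
move=> [fi fc fs] [gi gc gs]; split.
- by move=> s s' /fi/gi.
- by move=> t; apply: continuous_comp; [exact: fc|exact: gc].
- move=> t _; have [u _ <-] := gs t I; have [v _ <-] := fs u I.
  by exists v.
Qed.

Lemma Lambda_inv f : Lambda f ->
  exists2 g : U -> U, Lambda g & cancel f g /\ cancel g f.
Proof.
move=> [fi fc fs].
have [g gE] : exists g : U -> U, forall t, f (g t) = t.
  have ex t : exists u, f u = t by have [u _ ut] := fs t I; exists u.
  have [h hE] := boolp.choice ex; by exists h.
have fg : cancel f g by move=> t; apply: (incr_inj fi); rewrite gE.
have gi : incr g by move=> s s' ss; apply: (incr_inv fi); rewrite !gE.
have gs : set_surj setT setT g by move=> t _; exists (f t).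
by exists g => //; split => //; exact: incr_surj_continuous.
Qed.

Record gauge_axioms (gauge : (U -> U) -> \bar R) : Prop := GaugeAxioms {
  gauge_id : (gauge id <= 0)%E ;
  gauge_inv : forall f g, Lambda f -> Lambda g -> cancel f g -> cancel g f ->
    (gauge g <= gauge f)%E ;
  gauge_comp : forall f g, Lambda f -> Lambda g ->
    (gauge (g \o f) <= gauge f + gauge g)%E ;
  gauge_ge0 : forall f, (0 <= gauge f)%E }.

Definition edist_axioms (T : Type) (d : T -> T -> \bar R) : Prop :=
  [/\ (forall x y, 0 <= d x y)%E, (forall x, d x x = 0)%E,
      (forall x y, d x y = d y x)
    & (forall x y z, d x z <= d x y + d y z)%E].

Lemma unitI0 : exists t : U, True.
Proof. by have [|t _] := @unitI_mk 0; [rewrite lexx ler01|exists t]. Qed.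

Lemma ereal_sup_bound (S : set (\bar R)) b :
  (forall r, S r -> r <= b)%E -> (ereal_sup S <= b)%E.
Proof. by move=> h; apply: ge_ereal_sup => r /h. Qed.

Lemma lognorm_gauge : gauge_axioms (@lognorm R).
Proof.
split.
- apply: ereal_sup_bound => _ [[s s'] /= ss <-].
  by rewrite divff ?subr_eq0 ?gt_eqF// ln1 normr0.
- move=> f g [fi _ _] [gi _ _] fg gf.
  apply: ereal_sup_bound => _ [[s s'] /= ss <-].
  apply: ereal_sup_ubound; exists (g s, g s') => /=; first exact: gi.
  rewrite !gf -invf_div lnV ?normrN// posrE divr_gt0// subr_gt0//.
  exact: gi.
- move=> f g [fi _ _] [gi _ _].
  apply: ereal_sup_bound => _ [[s s'] /= ss <-].
  have -> : (val (g (f s')) - val (g (f s))) / (val s' - val s) =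
     (val (f s') - val (f s)) / (val s' - val s) *
     ((val (g (f s')) - val (g (f s))) / (val (f s') - val (f s))).
    rewrite [RHS]mulrC mulrA divfK//.
    by rewrite subr_eq0 gt_eqF//; exact: fi.
  rewrite lnM ?posrE ?divr_gt0 ?subr_gt0//; try by [exact: fi|exact/gi/fi].
  apply: (@le_trans _ _ (`|ln ((val (f s') - val (f s)) / (val s' - val s))|%:E
    + `|ln ((val (g (f s')) - val (g (f s))) / (val (f s') - val (f s)))|%:E)%E).
    by rewrite -EFinD lee_fin ler_normD.
  apply: leeD; apply: ereal_sup_ubound; first by exists (s, s').
  by exists (f s, f s') => //=; exact: fi.
- move=> f; have [|a aE] := @unitI_mk 0; first by rewrite lexx ler01.
  have [|b bE] := @unitI_mk 1; first by rewrite lexx ler01.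
  apply: (@le_trans _ _ (`|ln ((val (f b) - val (f a)) / (val b - val a))|%:E)).
    by rewrite lee_fin.
  by apply: ereal_sup_ubound; exists (a, b) => //=; rewrite aE bE ltr01.
Qed.

Lemma unifnorm_gauge : gauge_axioms (@unifnorm R).
Proof.
split.
- by apply: ereal_sup_bound => _ [t _ <-]; rewrite subrr normr0.
- move=> f g _ _ fg gf; apply: ereal_sup_bound => _ [t _ <-].
  by apply: ereal_sup_ubound; exists (g t) => //; rewrite gf distrC.
- move=> f g _ _; apply: ereal_sup_bound => _ [t _ <-].
  apply: (@le_trans _ _ (`|val (f t) - val t|%:E
                         + `|val (g (f t)) - val (f t)|%:E)%E).
    by rewrite -EFinD lee_fin [leRHS]addrC ler_distD.
  apply: leeD; apply: ereal_sup_ubound; first by exists t.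
  by exists (f t).
- move=> f; have [t _] := unitI0.
  apply: (@le_trans _ _ (`|val (f t) - val t|%:E)); first by rewrite lee_fin.
  by apply: ereal_sup_ubound; exists t.
Qed.

Section skorokhod.
Variables (T : Type) (gauge : (U -> U) -> \bar R) (d : T -> T -> \bar R).
Hypotheses (gaugeP : gauge_axioms gauge) (dP : edist_axioms d).

Lemma skorokhod_edist : edist_axioms (skorokhod gauge d).
Proof.
have [d0 dxx dC dtr] := dP; have [g1 gV gM g0] := gaugeP.
have ge0 x y : (0 <= skorokhod gauge d x y)%E.
  by apply: le_ereal_inf_tmp => _ [lam _ <-]; rewrite le_max g0.
have symle x y : (skorokhod gauge d x y <= skorokhod gauge d y x)%E.
  apply: le_ereal_inf_tmp => _ [f Lf <-].
  have [g Lg [fg gf]] := Lambda_inv Lf.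
  apply: (@le_trans _ _ (maxe (gauge g)
    (ereal_sup (range (fun t => d (x t) (y (g t))))))).
    by apply: ereal_inf_lbound; exists g.
  rewrite ge_max !le_max gV//=; apply/orP; right.
  apply: ereal_sup_bound => _ [t _ <-].
  by apply: ereal_sup_ubound; exists (g t) => //; rewrite gf dC.
split => //.
- move=> x; apply/eqP; rewrite eq_le ge0 andbT.
  apply: (@le_trans _ _ (maxe (gauge id)
    (ereal_sup (range (fun t => d (x t) (x (id t))))))).
    by apply: ereal_inf_lbound; exists id => //; exact: Lambda_id.
  rewrite ge_max g1; apply: ereal_sup_bound => _ [t _ <-].
  by rewrite dxx.
- by move=> x y; apply/eqP; rewrite eq_le !symle.
- move=> x y z.
  have [->|yz] := eqVneq (skorokhod gauge d y z) +oo%E.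
    by rewrite addey ?leey// -ltNye (lt_le_trans _ (ge0 _ _)).
  have yzf : skorokhod gauge d y z \is a fin_num.
    by rewrite ge0_fin_numE ?ltey.
  rewrite -leeBlDr//; apply: le_ereal_inf_tmp => _ [f Lf <-].
  rewrite leeBlDr//.
  have [|M0] := eqVneq (maxe (gauge f)
     (ereal_sup (range (fun t => d (x t) (y (f t)))))) +oo%E.
    by move=> ->; rewrite addye ?leey// -ltNye (lt_le_trans _ (ge0 _ _)).
  set M := maxe _ _ in M0 *.
  have Mf : M \is a fin_num.
    by rewrite ge0_fin_numE ?ltey// /M le_max g0.
  rewrite addeC -leeBlDr//; apply: le_ereal_inf_tmp => _ [g Lg <-].
  rewrite leeBlDr//; set N := maxe _ _.
  apply: (@le_trans _ _ (maxe (gauge (g \o f))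
    (ereal_sup (range (fun t => d (x t) (z ((g \o f) t))))))).
    by apply: ereal_inf_lbound; exists (g \o f) => //; exact: Lambda_comp.
  rewrite ge_max; apply/andP; split.
    by rewrite addeC (le_trans (gM _ _ Lf Lg))// leeD// le_max lexx.
  apply: ereal_sup_bound => _ [t _ <-].
  apply: (le_trans (dtr _ (y (f t)) _)); rewrite addeC; apply: leeD.
    rewrite le_max; apply/orP; right.
    by apply: ereal_sup_ubound; exists (f t).
  rewrite le_max; apply/orP; right.
  by apply: ereal_sup_ubound; exists t.
Qed.

End skorokhod.

Lemma abs_edist : edist_axioms (fun a b : R => `|a - b|%:E).
Proof.
split.
- by move=> x y; rewrite lee_fin.
- by move=> x; rewrite subrr normr0.
- by move=> x y; rewrite distrC.
- by move=> x y z; rewrite -EFinD lee_fin ler_distD.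
Qed.

End skorokhod_pseudometric.

Section edist_ball.
Context {R : realType} {T : Type} (d : T -> T -> \bar R).
Hypothesis dP : edist_axioms d.

Definition edist_ball (x : T) (e : R) : set T := [set y | (d x y < e%:E)%E].

Lemma edist_ball_center x e : 0 < e -> edist_ball x e x.
Proof. by have [_ d0 _ _] := dP; rewrite /edist_ball/= d0 lte_fin. Qed.

Lemma edist_ball_sym x y e : edist_ball x e y -> edist_ball y e x.
Proof. by have [_ _ dC _] := dP; rewrite /edist_ball/= dC. Qed.

Lemma edist_ball_triangle x y z e1 e2 :
  edist_ball x e1 y -> edist_ball y e2 z -> edist_ball x (e1 + e2) z.
Proof.
have [_ _ _ dtr] := dP; rewrite /edist_ball/= => xy yz.
by apply: (le_lt_trans (dtr _ y _)); rewrite EFinD lteD.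
Qed.

End edist_ball.

Record DR (R : realType) := MkDR {
  DR_fun :> unitI R -> R ;
  DR_right_cont : right_cont DR_fun ;
  DR_left_limits : left_limits DR_fun }.

Definition dJ1 (R : realType) (x y : DR R) : \bar R :=
  skorokhod (@lognorm R) (fun a b : R => `|a - b|%:E) x y.

Lemma dJ1_edist (R : realType) : edist_axioms (@dJ1 R).
Proof.
have [h1 h2 h3 h4] := skorokhod_edist (@lognorm_gauge R) (@abs_edist R).
by split => *; [exact: h1|exact: h2|exact: h3|exact: h4].
Qed.

Section DR_instances.
Variable R : realType.

HB.instance Definition _ := gen_eqMixin (DR R).
HB.instance Definition _ := gen_choiceMixin (DR R).

Let zero_right_cont : right_cont (fun _ : unitI R => 0 : R).
Proof. by move=> t _; exact: cvg_cst. Qed.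

Let zero_left_limits : left_limits (fun _ : unitI R => 0 : R).
Proof. by move=> t _; exists 0; exact: cvg_cst. Qed.

HB.instance Definition _ := isPointed.Build (DR R)
  (MkDR zero_right_cont zero_left_limits).

HB.instance Definition _ := hasNbhs.Build (DR R)
  (nbhs_ (entourage_ (edist_ball (@dJ1 R)))).

HB.instance Definition _ := Nbhs_isPseudoMetric.Build R (DR R)
  erefl (edist_ball_center (@dJ1_edist R)) (edist_ball_sym (@dJ1_edist R))
  (edist_ball_triangle (@dJ1_edist R)) erefl.

End DR_instances.

Record DDR (R : realType) := MkDDR {
  DDR_fun :> unitI R -> DR R ;
  DDR_right_cont : right_cont DDR_fun ;
  DDR_left_limits : left_limits DDR_fun }.

Definition dDD (R : realType) (x y : DDR R) : \bar R :=
  skorokhod (@unifnorm R) (@dJ1 R) x y.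

Lemma dDD_edist (R : realType) : edist_axioms (@dDD R).
Proof.
have [h1 h2 h3 h4] := skorokhod_edist (@unifnorm_gauge R) (@dJ1_edist R).
by split => *; [exact: h1|exact: h2|exact: h3|exact: h4].
Qed.

Section DDR_instances.
Variable R : realType.

HB.instance Definition _ := gen_eqMixin (DDR R).
HB.instance Definition _ := gen_choiceMixin (DDR R).

Let point_right_cont : right_cont (fun _ : unitI R => point : DR R).
Proof. by move=> t _; exact: cvg_cst. Qed.

Let point_left_limits : left_limits (fun _ : unitI R => point : DR R).
Proof. by move=> t _; exists point; exact: cvg_cst. Qed.

HB.instance Definition _ := isPointed.Build (DDR R)
  (MkDDR point_right_cont point_left_limits).

HB.instance Definition _ := hasNbhs.Build (DDR R)
  (nbhs_ (entourage_ (edist_ball (@dDD R)))).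

HB.instance Definition _ := Nbhs_isPseudoMetric.Build R (DDR R)
  erefl (edist_ball_center (@dDD_edist R)) (edist_ball_sym (@dDD_edist R))
  (edist_ball_triangle (@dDD_edist R)) erefl.

End DDR_instances.

Notation borelDDR R := (g_sigma_algebraType (@open (DDR R))).

Definition normD (R : realType) (x : DR R) : \bar R :=
  ereal_sup (range (fun s => `|x s|%:E)).

Definition normDD (R : realType) (x : DDR R) : \bar R :=
  ereal_sup (range (fun t => normD (x t))).

Definition sparse (R : realType) (delta : R) (v : nat) (t : nat -> R) :=
  [/\ t 0%N = 0, t v = 1, (forall i, (i < v)%N -> t i < t i.+1)
    & (forall i, (i < v)%N -> delta < t i.+1 - t i)].

Definition osc (R : realType) (T : Type) (d : T -> T -> \bar R)
    (x : unitI R -> T) (a b : R) : \bar R :=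
  ereal_sup [set d (x p.1) (x p.2)
            | p in [set p : unitI R * unitI R |
                    (a <= val p.1 < b) /\ (a <= val p.2 < b)]].

Definition modulus (R : realType) (T : Type) (d : T -> T -> \bar R)
    (x : unitI R -> T) (delta : R) : \bar R :=
  ereal_inf [set r | exists v (t : nat -> R), sparse delta v t /\
    r = \big[maxe/-oo%E]_(i < v) osc d x (t i) (t i.+1)].

Definition wD (R : realType) (x : DR R) (delta : R) : \bar R :=
  modulus (fun a b : R => `|a - b|%:E) x delta.

Definition wDD (R : realType) (x : DDR R) (delta : R) : \bar R :=
  modulus (@dJ1 R) x delta.

Definition tight (R : realType) (J : Type)
    (P : J -> probability (borelDDR R) R) : Prop :=
  forall eta : R, 0 < eta ->
    exists K : set (DDR R), compact K /\ forall j, ((1 - eta)%:E <= P j K)%E.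

(* The event "[wD (x t) delta >= eps] for some [t]" is a projection of a Borel
   set and need not be Borel, whereas a library measure is unconstrained on
   non-measurable sets. [outer P] is the outer measure of [P]: it agrees with
   [P] on measurable sets ([measurable_mu_extE]), and with the completion of [P]
   on the sets measurable for the completion. *)
Definition outer (R : realType) d (T : measurableType d) (P : probability T R)
  : set T -> \bar R := mu_ext P.

(* Main.v *)
Require Import Defs.
From mathcomp Require Import all_boot all_order all_algebra.
From mathcomp Require Import all_classical all_reals all_analysis.
From mathcomp Require Import ring lra.

Import Order.TTheory GRing.Theory Num.Theory.
Import numFieldNormedType.Exports.
Local Open Scope classical_set_scope.
Local Open Scope ring_scope.

Set Implicit Arguments.
Unset Strict Implicit.
Unset Printing Implicit Defensive.

(** The theorem is an Arzela-Ascoli theorem for functions with values in D,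
    combined with the usual passage from compactness to tightness.

    Compactness. Skorokhod distances are treated once, over an arbitrary space
    of values [T] with a distance [d], and used twice: with real values, and
    with values in D. The logarithmic gauge is used at both levels; it dominates
    the uniform gauge, and makes the distance complete
    ([skorokhod_rapidly_complete]). Suppose that a family of functions takes its
    values in a totally bounded set and has a uniformly small modulus. Up to a
    small error a function of the family is given by the points of a sparse
    partition and by its values there, which are finitely many parameters in
    totally bounded spaces; two functions with nearby parameters are close,
    through the polygonal time change that matches the partitions
    ([partition_interpolation], [adapted_close]). Hence the family is totally
    bounded ([skorokhod_totally_bounded]). Applied to the set of all values
    [x t], and then to the functions [x] themselves, this shows that a closed
    set is compact as soon as the norms are bounded and both moduli tend to zero
    uniformly on it ([equiregular_compact]).

    The conditions. For each of the three quantities, the set [S n] of functions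
    on which it is small (or bounded by [n]) increases with [n], and every
    function has a neighbourhood inside some [S n]. For the norm and for the
    outer modulus the sets are even open, which makes the events of (i) and
    (iii) measurable. For the inner modulus this uses that the values of a
    single function are totally bounded ([wD_uniform]). Two consequences follow.
    A compact set lies in a single [S n] ([compact_exhausting]), so tightness
    implies the three conditions. And for one probability measure the outer
    measure of the complement of [S n] tends to zero ([exhausting_outer]), so
    that the finitely many measures ignored by an upper limit do no harm, and
    the three conditions hold uniformly in the sequence. Discarding countably
    many events of small total outer measure then leaves a set to which the
    compactness criterion applies ([uniformly_exhausted_tight]). *)

(** * Rapidly convergent sequences *)

Section rapid_sequences.
Variable R : realType.

Definition hpow (n : nat) : R := 2^-1 ^+ n.

Lemma hpow_gt0 n : 0 < hpow n.
Proof. by rewrite exprn_gt0// invr_gt0. Qed.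

Lemma hpow_ge0 n : 0 <= hpow n.
Proof. exact/ltW/hpow_gt0. Qed.

Lemma hpowS n : hpow n = 2 * hpow n.+1.
Proof. by rewrite /hpow exprS mulrA mulfV ?mul1r. Qed.

Lemma hpow_le1 n : hpow n <= 1.
Proof. by rewrite exprn_ile1// ?invr_ge0// invf_le1// ler1n. Qed.

Lemma hpow_anti m n : (m <= n)%N -> hpow n <= hpow m.
Proof.
move=> /subnKC <-; elim: (n - m)%N => [|k ih]; first by rewrite addn0.
rewrite addnS (le_trans _ ih)// [leRHS]hpowS.
by have := hpow_gt0 (m + k).+1; lra.
Qed.

Lemma hpow_small (e : R) : 0 < e -> exists n, hpow n < e.
Proof.
move=> e0; exists (Num.truncn e^-1).+1; set n := Num.truncn _.
rewrite /hpow exprVn -[ltRHS]invrK ltf_pV2 ?posrE ?exprn_gt0 ?invr_gt0//.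
apply: (lt_trans (truncnS_gt _)); rewrite -natrX ltr_nat.
exact: ltn_expl.
Qed.

(** The limit is the supremum of the lower ends of the nested intervals of
    radius [2 * C * hpow n] around the terms. *)
Lemma rapid_real (C : R) (u : nat -> R) :
  (forall n, `|u n - u n.+1| <= C * hpow n) ->
  exists l, forall n, `|u n - l| <= 2 * C * hpow n.
Proof.
move=> hu.
have C0 : 0 <= C.
  by have := le_trans (normr_ge0 _) (hu 0%N); rewrite /hpow expr0 mulr1.
have tail n k : `|u n - u (n + k)%N| <= 2 * C * (hpow n - hpow (n + k)).
  elim: k => [|k ih]; first by rewrite addn0 !subrr normr0 mulr0.
  rewrite addnS; apply: (le_trans (ler_distD (u (n + k)%N) _ _)).
  apply: (le_trans (lerD ih (hu _))); rewrite [hpow (n + k)]hpowS.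
  by rewrite le_eqVlt; apply/orP; left; apply/eqP; ring.
have tail' n m : (n <= m)%N -> `|u n - u m| <= 2 * C * hpow n.
  move=> nm; have := tail n (m - n)%N; rewrite subnKC// => /le_trans; apply.
  by rewrite ler_wpM2l ?mulr_ge0// gerBl hpow_ge0.
pose S := [set u n - 2 * C * hpow n | n in [set: nat]].
have bound n m : u n - 2 * C * hpow n <= u m + 2 * C * hpow m.
  have /orP[nm|nm] := leq_total n m.
    have := tail' _ _ nm; rewrite ler_norml => /andP[_].
    have : 0 <= 2 * C * hpow m by rewrite !mulr_ge0 ?hpow_ge0.
    by lra.
  have := tail' _ _ nm; rewrite ler_norml => /andP[].
  have : 0 <= 2 * C * hpow n by rewrite !mulr_ge0 ?hpow_ge0.
  by lra.
have S0 : S !=set0 by exists (u 0%N - 2 * C * hpow 0), 0%N.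
exists (sup S) => n; rewrite ler_distlC; apply/andP; split.
  apply: ub_le_sup; last by exists n.
  by exists (u 0%N + 2 * C * hpow 0) => _ [m _ <-].
by apply: ge_sup => // _ [m _ <-].
Qed.

Lemma finite_common (v : nat) (Q : nat -> R -> Prop) :
  (forall i a b, a <= b -> Q i b -> Q i a) ->
  (forall i, (i < v)%N -> exists2 a : R, 0 < a & Q i a) ->
  exists2 a : R, 0 < a & forall i, (i < v)%N -> Q i a.
Proof.
move=> Qmono; elim: v => [|v ih] h; first by exists 1.
have [i iv|a a0 ha] := ih; first by apply: h; rewrite ltnS ltnW.
have [b b0 hb] := h v (ltnSn v).
exists (Num.min a b) => [|i]; first by rewrite lt_min a0.
rewrite ltnS leq_eqVlt => /orP[/eqP->|iv].
  by apply: Qmono hb; rewrite ge_min lexx orbT.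
by apply: Qmono (ha _ iv); rewrite ge_min lexx.
Qed.

End rapid_sequences.
Arguments hpow {R} n.

(** * Time changes *)

Section time_changes.
Variable R : realType.
Notation U := (unitI R).
Implicit Types (f g : U -> U) (c delta : R).

Lemma val_unitI_ge0 (u : U) : 0 <= val u.
Proof. by have /andP[] := unitI_bounds u. Qed.

Lemma val_unitI_le1 (u : U) : val u <= 1.
Proof. by have /andP[] := unitI_bounds u. Qed.

Lemma unitI_inj (u u' : U) : val u = val u' -> u = u'.
Proof. exact: val_inj. Qed.

Lemma clamp_bounds (r : R) : 0 <= Num.max 0 (Num.min r 1) <= 1.
Proof. by rewrite le_max lexx/= ge_max ler01/= ge_min lexx orbT. Qed.

(** A point of the unit interval for every real number, so that functions on
    the interval extend to the line and partition points can be evaluated. *)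
Definition clamp (r : R) : U := sval (cid (unitI_mk (clamp_bounds r))).

Lemma val_clamp r : val (clamp r) = Num.max 0 (Num.min r 1).
Proof. by rewrite /clamp; case: cid. Qed.

Lemma clamp_lipschitz r r' : `|val (clamp r) - val (clamp r')| <= `|r - r'|.
Proof.
have := ler_norm (r - r'); have := ler_norm (r' - r); rewrite distrC => h1 h2.
rewrite !val_clamp ler_norml /Num.min; apply/andP; split;
  by case: (ltP r 1) => ?; case: (ltP r' 1) => ?; rewrite /Num.max;
     do 2?[case: ifPn; rewrite -?leNgt => ?]; lra.
Qed.

Lemma clampE r : 0 <= r <= 1 -> val (clamp r) = r.
Proof.
move=> /andP[r0 r1]; rewrite /clamp; case: cid => u /= ->.
by rewrite (min_idPl r1) (max_idPr r0).
Qed.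

Lemma val_clamp0 : val (clamp 0) = 0.
Proof. by rewrite clampE// lexx ler01. Qed.

Lemma val_clamp1 : val (clamp 1) = 1.
Proof. by rewrite clampE// lexx ler01. Qed.

Lemma Lambda0 f (u : U) : Lambda f -> val u = 0 -> val (f u) = 0.
Proof.
move=> [fi _ fs] u0; have [w _ fw] := fs (clamp 0) I.
have [uw|wu|/unitI_inj uw] := ltgtP (val u) (val w).
- have := fi _ _ uw; rewrite fw val_clamp0 => /lt_geF.
  by rewrite val_unitI_ge0.
- by have := le_lt_trans (val_unitI_ge0 w) wu; rewrite u0 ltxx.
- by rewrite uw fw val_clamp0.
Qed.

Lemma Lambda1 f (u : U) : Lambda f -> val u = 1 -> val (f u) = 1.
Proof.
move=> [fi _ fs] u1; have [w _ fw] := fs (clamp 1) I.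
have [uw|wu|/unitI_inj uw] := ltgtP (val u) (val w).
- by have := lt_le_trans uw (val_unitI_le1 w); rewrite u1 ltxx.
- have := fi _ _ wu; rewrite fw val_clamp1 => /lt_geF.
  by rewrite val_unitI_le1.
- by rewrite uw fw val_clamp1.
Qed.

Lemma Lambda_lt f : Lambda f -> forall s s', val s < val s' ->
  val (f s) < val (f s').
Proof. by case. Qed.

Lemma Lambda_le f : Lambda f -> forall s s', val s <= val s' ->
  val (f s) <= val (f s').
Proof.
move=> Lf s s'; rewrite le_eqVlt => /orP[/eqP/unitI_inj-> //|ss].
exact/ltW/(Lambda_lt Lf).
Qed.

Lemma lognorm_leP f c : (forall u u', val u < val u' -> val (f u) < val (f u')) ->
  (lognorm f <= c%:E)%E <->
  forall u u', val u < val u' ->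
    expR (- c) * (val u' - val u) <= val (f u') - val (f u) <=
    expR c * (val u' - val u).
Proof.
move=> fi.
have key (u u' : U) : val u < val u' ->
  (`|ln ((val (f u') - val (f u)) / (val u' - val u))| <= c) =
  (expR (- c) * (val u' - val u) <= val (f u') - val (f u) <=
    expR c * (val u' - val u)).
  move=> uu; have d0 : 0 < val u' - val u by rewrite subr_gt0.
  have q0 : 0 < (val (f u') - val (f u)) / (val u' - val u).
    by rewrite divr_gt0// subr_gt0; exact: fi.
  rewrite ler_norml -(ler_expR (- c)) -(ler_expR _ c) lnK ?posrE//.
  by rewrite ler_pdivlMr// ler_pdivrMr.
split=> [h u u' uu|h].
  rewrite -key// -lee_fin; apply: le_trans h; apply: ereal_sup_ubound.
  by exists (u, u').
by apply: ereal_sup_bound => _ [[u u'] /= uu <-]; rewrite lee_fin key// h.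
Qed.

(** The bi-Lipschitz bounds make the extension of [f] to the line continuous,
    so surjectivity is the intermediate value theorem. *)
Lemma Lambda_bilipschitz f c :
  val (f (clamp 0)) = 0 -> val (f (clamp 1)) = 1 ->
  (forall u u', val u < val u' ->
    expR (- c) * (val u' - val u) <= val (f u') - val (f u) <=
    expR c * (val u' - val u)) ->
  Lambda f /\ (lognorm f <= c%:E)%E.
Proof.
move=> f0 f1 h.
have fi : incr f.
  move=> u u' uu; have /andP[+ _] := h _ _ uu; rewrite -subr_gt0.
  by apply: lt_le_trans; rewrite mulr_gt0 ?expR_gt0// subr_gt0.
split; last exact/lognorm_leP.
suff fs : set_surj setT setT f by split => //; exact: incr_surj_continuous.
move=> w _; pose F r := val (f (clamp r)).
have lip (u u' : U) : `|val (f u) - val (f u')| <= expR c * `|val u - val u'|.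
  wlog uu : u u' / val u <= val u'.
    move=> hw; have /orP[|/hw] := le_total (val u) (val u'); first exact: hw.
    by rewrite distrC [`|val u' - _|]distrC.
  move: uu; rewrite le_eqVlt => /orP[/eqP/unitI_inj->|uu].
    by rewrite !subrr normr0 mulr0.
  rewrite distrC [`|val u - _|]distrC gtr0_norm ?subr_gt0 ?fi//.
  by rewrite gtr0_norm ?subr_gt0//; have /andP[] := h _ _ uu.
have Fc : {within `[0, 1], continuous F}.
  apply: continuous_subspaceT => r; apply/cvgrPdist_lt => e e0.
  have E0 : 0 < e / expR c by rewrite divr_gt0 ?expR_gt0.
  near=> r'; apply: (le_lt_trans (lip _ _)).
  rewrite mulrC -ltr_pdivlMr ?expR_gt0//.
  by apply: (le_lt_trans (clamp_lipschitz _ _)); near: r'; exact: cvgr_dist_lt.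
have [|r _ Fr] := @IVT R F 0 1 (val w) ler01 Fc.
  by rewrite /F f0 f1 min_l// max_r// unitI_bounds.
by exists (clamp r) => //; exact: unitI_inj.
Unshelve. all: by end_near. Qed.

Lemma sparse_mono delta v (t : nat -> R) i j :
  sparse delta v t -> (i <= j)%N -> (j <= v)%N -> t i <= t j.
Proof.
move=> [_ _ ti _] /subnKC <-; elim: (j - i)%N => [|k ih]; first by rewrite addn0.
rewrite addnS => kv; apply: (le_trans (ih _)); first exact: ltnW.
exact/ltW/ti.
Qed.

Lemma sparse_unitI delta v (t : nat -> R) i :
  sparse delta v t -> (i <= v)%N -> 0 <= t i <= 1.
Proof.
move=> st iv; have [t0 tv _ _] := st; apply/andP; split.
  by rewrite -t0 (sparse_mono st).
by rewrite -tv (sparse_mono st).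
Qed.

Lemma sparse_piece delta v (t : nat -> R) r : sparse delta v t ->
  0 <= r < 1 -> exists2 i, (i < v)%N & t i <= r < t i.+1.
Proof.
move=> [t0 tv _ _]; rewrite -{}tv -{}t0 => /andP[].
elim: v => [/le_lt_trans h /h|v ih r0]; first by rewrite ltxx.
have [/(ih r0)[i iv hi] _|tr rt] := ltP r (t v).
  by exists i; rewrite // ltnW.
by exists v; rewrite // tr.
Qed.

Lemma sparse_piece_left delta v (t : nat -> R) r : sparse delta v t ->
  0 < r <= 1 -> exists2 i, (i < v)%N & t i < r <= t i.+1.
Proof.
move=> [t0 tv _ _]; rewrite -{}tv -{}t0 => /andP[].
elim: v => [/lt_le_trans h /h|v ih r0]; first by rewrite ltxx.
have [/(ih r0)[i iv hi] _|tr rt] := leP r (t v).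
  by exists i; rewrite // ltnW.
by exists v; rewrite // tr.
Qed.

Lemma sparse_anti delta delta' v (t : nat -> R) : delta' <= delta ->
  sparse delta v t -> sparse delta' v t.
Proof. by move=> dd [? ? ? h]; split => // i /h; exact: le_lt_trans. Qed.

(** The polygon through the points [(t i, s i)], written as a sum of ramps, so
    that both Lipschitz bounds can be checked slope by slope: each ramp is
    nondecreasing, and with all slopes equal to [1] the sum is the identity. *)
Lemma partition_interpolation c a b v (t s : nat -> R) :
  sparse a v t -> sparse b v s ->
  (forall i, (i < v)%N -> expR (- c) * (t i.+1 - t i) <= s i.+1 - s i <=
    expR c * (t i.+1 - t i)) ->
  exists f, [/\ Lambda f, (lognorm f <= c%:E)%E &
    forall i (u : U), (i < v)%N -> t i <= val u < t i.+1 ->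
      s i <= val (f u) < s i.+1].
Proof.
move=> st ss slope; have [t0 tv ti _] := st; have [s0 sv si _] := ss.
pose sg i := (s i.+1 - s i) / (t i.+1 - t i).
pose ramp i r := Num.min r (t i.+1) - Num.min r (t i).
pose F r := \sum_(0 <= i < v) sg i * ramp i r.
have ramp_id r : 0 <= r <= 1 -> \sum_(0 <= i < v) ramp i r = r.
  move=> /andP[r0 r1]; rewrite telescope_sumr// tv t0.
  by rewrite (min_idPl r1) (min_idPr r0) subr0.
have ramp_le i r r' : (i < v)%N -> r <= r' -> ramp i r <= ramp i r'.
  move=> /ti tt rr; rewrite /ramp /Num.min.
  by do ![case: ifPn => [?|]; rewrite -?leNgt]; move=> *; lra.
have Finc r r' : 0 <= r -> r < r' -> r' <= 1 ->
    expR (- c) * (r' - r) <= F r' - F r <= expR c * (r' - r).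
  move=> r0 rr r1.
  have r01 : 0 <= r <= 1 by rewrite r0 (le_trans (ltW rr)).
  have r01' : 0 <= r' <= 1 by rewrite r1 (le_trans r0 (ltW rr)).
  rewrite -[X in _ * (X - _)]ramp_id// -[X in _ * (_ - X)]ramp_id// -!sumrB.
  rewrite -[X in _ <= _ <= _ * (X - _)]ramp_id//.
  rewrite -[X in _ <= _ <= _ * (_ - X)]ramp_id// -!sumrB !mulr_sumr.
  apply/andP; split; rewrite !big_mkord; apply: ler_sum => -[i iv] _ /=;
    rewrite -mulrBr; (apply: ler_wpM2r; first by rewrite subr_ge0 ramp_le ?ltW);
    have /andP[h1 h2] := slope _ iv.
  - by rewrite /sg ler_pdivlMr// subr_gt0 ti.
  - by rewrite /sg ler_pdivrMr// subr_gt0 ti.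
have Ft j : (j <= v)%N -> F (t j) = s j.
  move=> jv; rewrite /F (eq_big_nat _ _ (F2 := fun i =>
      s (minn i.+1 j) - s (minn i j))).
    by rewrite telescope_sumr// (minn_idPr jv) min0n s0 subr0.
  move=> i /andP[_ iv]; rewrite /ramp; have [ji|ij] := leqP j i.
    rewrite !(minn_idPr _) ?(leqW ji)// !(min_idPl _) ?subrr ?mulr0//;
      by apply: (sparse_mono st) => //; first [exact: leqW|exact: ltnW].
  rewrite (minn_idPl ij) !(min_idPr _).
  - by rewrite /sg divfK// subr_eq0 gt_eqF// ti.
  - by apply: (sparse_mono st) => //; exact: ltnW.
  - by apply: (sparse_mono st).
have F0 : F 0 = 0 by rewrite -[in LHS]t0 Ft.
have F1 : F 1 = 1 by rewrite -[in LHS]tv Ft.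
have Fle r r' : 0 <= r -> r <= r' -> r' <= 1 -> F r <= F r'.
  move=> r0; rewrite le_eqVlt => /orP[/eqP-> //|rr] r1.
  have /andP[+ _] := Finc _ _ r0 rr r1; rewrite -(subr_ge0 (F r)); apply: le_trans.
  by rewrite mulr_ge0 ?expR_ge0// subr_ge0 ltW.
have Flt r r' : 0 <= r -> r < r' -> r' <= 1 -> F r < F r'.
  move=> r0 rr r1.
  have /andP[+ _] := Finc _ _ r0 rr r1; rewrite -subr_gt0; apply: lt_le_trans.
  by rewrite mulr_gt0 ?expR_gt0// subr_gt0.
have F01 r : 0 <= r <= 1 -> 0 <= F r <= 1.
  move=> /andP[r0 r1]; apply/andP; split; first by rewrite -F0 Fle.
  by rewrite -F1 Fle.
pose f (u : U) := clamp (F (val u)).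
have fE u : val (f u) = F (val u) by rewrite clampE// F01// unitI_bounds.
have [|||Lf lf] := @Lambda_bilipschitz f c.
- by rewrite fE val_clamp0 F0.
- by rewrite fE val_clamp1 F1.
- by move=> u u' uu; rewrite !fE Finc// ?val_unitI_ge0 ?val_unitI_le1.
exists f; split => // i u iv /andP[tu ut].
have /andP[ti0 _] := sparse_unitI st (ltnW iv).
have /andP[_ ti1] := sparse_unitI st iv.
rewrite fE -(Ft _ (ltnW iv)) -(Ft _ iv) Fle ?Flt ?val_unitI_ge0//.
exact: val_unitI_le1.
Qed.

End time_changes.

(** * Moduli of continuity *)

Section modulus.
Variables (R : realType) (T : Type) (d : T -> T -> \bar R).
Hypothesis dP : edist_axioms d.
Notation U := (unitI R).
Implicit Types (x y : U -> T) (e delta : R).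

Lemma edist_sym_le a b e : (d a b <= e%:E)%E -> (d b a <= e%:E)%E.
Proof. by have [_ _ dC _] := dP; rewrite dC. Qed.

Lemma edist_triangle_le a b c e1 e2 :
  (d a b <= e1%:E -> d b c <= e2%:E -> d a c <= (e1 + e2)%:E)%E.
Proof.
by have [_ _ _ dtr] := dP => ab bc; rewrite (le_trans (dtr _ b _))// EFinD leeD.
Qed.

Lemma edist_refl_le a e : 0 <= e -> (d a a <= e%:E)%E.
Proof. by have [_ d0 _ _] := dP; rewrite d0 lee_fin. Qed.

Lemma edist_le_weaken a b e1 e2 : e1 <= e2 ->
  (d a b <= e1%:E)%E -> (d a b <= e2%:E)%E.
Proof. by move=> ee /le_trans; apply; rewrite lee_fin. Qed.

(** The partition [t] witnesses that the modulus at [delta] is at most [e];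
    oscillations are bounded point by point, which avoids suprema. *)
Definition adapted x delta e (v : nat) (t : nat -> R) :=
  sparse delta v t /\
  forall i, (i < v)%N -> forall p q : U,
    t i <= val p < t i.+1 -> t i <= val q < t i.+1 -> (d (x p) (x q) <= e%:E)%E.

Lemma modulus_ltP x delta e :
  (modulus d x delta < e%:E)%E <->
  exists e' v t, e' < e /\ adapted x delta e' v t.
Proof.
split.
- move=> /ereal_inf_lt[_ [v [t [st ->]]]] lt_e.
  have [e' [he' e'e]] : exists e' : R,
      (\big[maxe/-oo]_(i < v) osc d x (t i) (t i.+1) <= e'%:E)%E /\ e' < e.
    move: lt_e; case: (\big[_/_]_(_ < _) _) => [r|//|_].
      by rewrite lte_fin => re; exists r.
    by exists (e - 1); split; [rewrite leNye|rewrite ltrBlDr ltrDl].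
  exists e', v, t; split => //; split => // i iv p q hp hq.
  apply: le_trans he'; apply: (le_trans _ (le_bigmax _ _ (Ordinal iv))).
  by apply: ereal_sup_ubound; exists (p, q).
- move=> [e' [v [t [e'e [st h]]]]].
  apply: (@le_lt_trans _ _ e'%:E); last by rewrite lte_fin.
  apply: (@le_trans _ _ (\big[maxe/-oo]_(i < v) osc d x (t i) (t i.+1))%E).
    by apply: ereal_inf_lbound; exists v, t.
  apply: bigmax_le; first by rewrite leNye.
  move=> [i iv] _; apply: ereal_sup_bound => _ [[p q] [/= hp hq] <-].
  exact: h hq.
Qed.

Lemma modulus_anti x delta delta' : delta' <= delta ->
  (modulus d x delta' <= modulus d x delta)%E.
Proof.
move=> dd; apply: le_ereal_inf_tmp => _ [v [t [st ->]]].
by apply: ereal_inf_lbound; exists v, t; split => //; exact: sparse_anti st.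
Qed.

(** Sparseness is a strict condition on finitely many gaps, so it survives a
    slight increase of [delta]. *)
Lemma modulus_slack x delta e : (modulus d x delta < e%:E)%E ->
  exists delta' e', [/\ delta < delta', e' < e &
    (modulus d x delta' < e'%:E)%E].
Proof.
move=> /modulus_ltP[e' [v [t [e'e [st h]]]]].
have [t0 tv ti gap] := st.
have [k k0 hk] : exists2 k : R, 0 < k &
    forall i, (i < v)%N -> delta + k < t i.+1 - t i.
  apply: finite_common => [i a b ab|i iv].
    by apply: le_lt_trans; rewrite lerD2l.
  exists ((t i.+1 - t i - delta) / 2); first by rewrite divr_gt0// subr_gt0 gap.
  by have := gap _ iv; lra.
exists (delta + k), ((e' + e) / 2); split; [by rewrite ltrDl|lra|].
by apply/modulus_ltP; exists e', v, t; split; [lra|split].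
Qed.

(** The images of the partition points work: the gaps are controlled by the
    time change, and the oscillations by the triangle inequality. *)
Lemma adapted_transfer x y f delta delta' e eta v t : Lambda f ->
  (forall s s' : U, delta < val s' - val s -> delta' < val (f s') - val (f s)) ->
  (forall s, (d (x s) (y (f s)) <= eta%:E)%E) ->
  adapted x delta e v t -> exists t', adapted y delta' (e + 2 * eta) v t'.
Proof.
move=> Lf hf xy [st h]; have [t0 tv ti gap] := st.
have [g Lg [fg gf]] := Lambda_inv Lf.
have tE i : (i <= v)%N -> val (clamp (t i)) = t i.
  by move=> iv; rewrite clampE// (sparse_unitI st).
exists (fun i => val (f (clamp (t i)))); split; first split.
- by apply: Lambda0; rewrite // tE.
- by apply: Lambda1; rewrite // tE.
- by move=> i iv; apply: Lambda_lt; rewrite // !tE ?ti// ltnW.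
- by move=> i iv; apply: hf; rewrite !tE ?gap// ltnW.
move=> i iv p q.
have back (r : U) : val (f (clamp (t i))) <= val r < val (f (clamp (t i.+1))) ->
    t i <= val (g r) < t i.+1.
  move=> /andP[h1 h2]; have := Lambda_le Lg h1; have := Lambda_lt Lg h2.
  by rewrite !fg !tE// => [-> ->//|]; exact: ltnW.
move=> /back hp /back hq; have pq := h _ iv _ _ hp hq.
have xp := xy (g p); have xq := xy (g q); rewrite !gf in xp xq.
apply: (edist_le_weaken _
  (edist_triangle_le (edist_sym_le xp) (edist_triangle_le pq xq))).
by lra.
Qed.

Lemma modulus_transfer x y f delta delta' e eta : Lambda f ->
  (forall s s' : U, delta < val s' - val s -> delta' < val (f s') - val (f s)) ->
  (forall s, (d (x s) (y (f s)) <= eta%:E)%E) ->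
  (modulus d x delta < e%:E -> modulus d y delta' < (e + 2 * eta)%:E)%E.
Proof.
move=> Lf hf xy /modulus_ltP[e' [v [t [e'e h]]]].
have [t' h'] := adapted_transfer Lf hf xy h.
by apply/modulus_ltP; exists (e' + 2 * eta), v, t'; rewrite ltrD2r.
Qed.

(** Over a complete space this characterises the right-continuous functions
    with left limits, in a form that passes to Skorokhod limits. *)
Definition regular_path x :=
  forall e, 0 < e -> exists2 delta, 0 < delta & (modulus d x delta < e%:E)%E.

Definition right_continuous_at x (t : U) :=
  forall e, 0 < e -> exists2 eta : R, 0 < eta &
    forall s : U, val t <= val s < val t + eta -> (d (x t) (x s) <= e%:E)%E.

Definition left_limit_at x (t : U) (l : T) :=
  forall e, 0 < e -> exists2 eta : R, 0 < eta &
    forall s : U, val t - eta < val s < val t -> (d l (x s) <= e%:E)%E.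

(** Consider the largest [s] such that [0, s) splits into finitely many pieces
    of small oscillation: it is attained because of the left limit at [s], and
    right-continuity at [s] would allow one to go further if [s < 1]. *)
Lemma cadlag_regular x :
  (forall t, val t < 1 -> right_continuous_at x t) ->
  (forall t, 0 < val t -> exists l, left_limit_at x t l) ->
  regular_path x.
Proof.
move=> rc ll e e0.
pose small a b := forall p q : U, a <= val p < b -> a <= val q < b ->
  (d (x p) (x q) <= (e / 2)%:E)%E.
pose cut (b : R) := exists v t, [/\ t 0%N = 0, t v = b,
  (forall i, (i < v)%N -> t i < t i.+1) &
  forall i, (i < v)%N -> small (t i) (t i.+1)].
have cut_ext a b : cut a -> a < b -> small a b -> cut b.
  move=> [v [t [t0 tv ti th]]] ab sab.
  exists v.+1, (fun i => if (i <= v)%N then t i else b); split => /=.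
  - by rewrite t0.
  - by rewrite ltnn.
  - move=> i; rewrite ltnS; case: (ltngtP i v) => // [iv|->] _; first exact: ti.
    by rewrite tv.
  - move=> i; rewrite ltnS; case: (ltngtP i v) => // [iv|->] _; first exact: th.
    by rewrite tv.
pose S := [set b : R | 0 <= b <= 1 /\ cut b].
have S0 : S 0.
  by split; [rewrite lexx ler01|exists 0%N, (fun=> 0)].
have hS : has_sup S.
  by split; [exists 0|exists 1 => b [/andP[]]].
have s01 : 0 <= sup S <= 1.
  apply/andP; split; first by apply: ub_le_sup => //; case: hS.
  by apply: ge_sup; [exists 0|move=> b [/andP[]]].
set s := sup S in s01; have /andP[s0 s1] := s01.
have cs : cut s.
  have [<-|sn0] := eqVneq 0 s; first by case: S0.
  have sp : 0 < s by rewrite lt_neqAle sn0.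
  have [|l hl] := ll (clamp s); first by rewrite clampE.
  have [|k k0 hk] := hl (e / 4); first by rewrite divr_gt0.
  rewrite clampE// in hk.
  have [b [b01 cb] sb] := sup_adherent k0 hS.
  have bs : b <= s by apply: ub_le_sup; [case: hS|split].
  have [->|nbs] := eqVneq s b; first exact: cb.
  apply: (cut_ext _ _ cb); first by rewrite lt_neqAle eq_sym nbs.
  move=> p q /andP[bp ps] /andP[bq qs].
  have lp : (d l (x p) <= (e / 4)%:E)%E.
    by apply: hk; rewrite ps andbT (lt_le_trans _ bp).
  have lq : (d l (x q) <= (e / 4)%:E)%E.
    by apply: hk; rewrite qs andbT (lt_le_trans _ bq).
  apply: (edist_le_weaken _ (edist_triangle_le (edist_sym_le lp) lq)).
  by lra.
have cut1 : cut 1.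
  have [<- //|sn1] := eqVneq s 1.
  have sl1 : s < 1 by rewrite lt_neqAle sn1.
  have [||k k0 hk] := rc (clamp s) _ (e / 4); rewrite ?clampE// ?divr_gt0//.
  rewrite clampE// in hk.
  pose b := Num.min 1 (s + k / 2).
  have sb : s < b by rewrite lt_min sl1 ltrDl divr_gt0.
  have : cut b.
    apply: (cut_ext _ _ cs sb) => p q /andP[sp pb] /andP[sq qb].
    have bk : b <= s + k / 2 by rewrite ge_min lexx orbT.
    have lp : (d (x (clamp s)) (x p) <= (e / 4)%:E)%E.
      by apply: hk; rewrite sp/= (lt_le_trans pb)// (le_trans bk)//; lra.
    have lq : (d (x (clamp s)) (x q) <= (e / 4)%:E)%E.
      by apply: hk; rewrite sq/= (lt_le_trans qb)// (le_trans bk)//; lra.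
    apply: (edist_le_weaken _ (edist_triangle_le (edist_sym_le lp) lq)).
    by lra.
  move=> cb; have : b <= s.
    apply: ub_le_sup; first by case: hS.
    split => //; rewrite (le_trans s0 (ltW sb))/=.
    by rewrite ge_min lexx.
  by rewrite leNgt sb.
have [v [t [t0 tv ti th]]] := cut1.
have [k k0 hk] : exists2 k : R, 0 < k &
    forall i, (i < v)%N -> k < t i.+1 - t i.
  apply: finite_common => [i a b|i iv]; first exact: le_lt_trans.
  exists ((t i.+1 - t i) / 2); first by rewrite divr_gt0// subr_gt0 ti.
  by have := ti _ iv; lra.
exists k => //; apply/modulus_ltP; exists (e / 2), v, t; split; first lra.
by split.
Qed.

Lemma regular_right_continuous x (t : U) : regular_path x -> val t < 1 ->
  right_continuous_at x t.
Proof.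
move=> rx t1 e e0; have [k k0 /modulus_ltP[e' [v [w [e'e [sw h]]]]]] := rx _ e0.
have [|i iv /andP[wt tw]] := sparse_piece sw (r := val t).
  by rewrite t1 val_unitI_ge0.
exists (w i.+1 - val t) => [|s /andP[ts]]; first by rewrite subr_gt0.
rewrite addrC subrK => sw'; apply: edist_le_weaken (ltW e'e) _.
by apply: (h _ iv); rewrite ?wt ?tw// (le_trans wt).
Qed.

Lemma regular_left_cauchy x (t : U) e : regular_path x -> 0 < val t -> 0 < e ->
  exists2 a, 0 <= a < val t & forall p q : U, a <= val p < val t ->
    a <= val q < val t -> (d (x p) (x q) <= e%:E)%E.
Proof.
move=> rx t0 e0; have [k k0 /modulus_ltP[e' [v [w [e'e [sw h]]]]]] := rx _ e0.
have [|i iv /andP[wt tw]] := sparse_piece_left sw (r := val t).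
  by rewrite t0 val_unitI_le1.
exists (w i) => [|p q /andP[p1 p2] /andP[q1 q2]].
  by rewrite wt andbT; have /andP[] := sparse_unitI sw (ltnW iv).
apply: edist_le_weaken (ltW e'e) _; apply: (h _ iv).
  by rewrite p1 (lt_le_trans p2).
by rewrite q1 (lt_le_trans q2).
Qed.

(** Completeness tested on rapidly Cauchy sequences only, with an explicit rate
    so that limits can be taken uniformly in a parameter. *)
Definition rapidly_complete :=
  forall u : nat -> T, (forall n, (d (u n) (u n.+1) < (hpow n)%:E)%E) ->
  exists l, forall n, (d (u n) l <= (2 * hpow n)%:E)%E.

(** The intervals on which [x] oscillates by at most [hpow n.+1] need not be
    nested, so the sample points are taken at the running maxima [A n] of their
    left ends. *)
Lemma regular_left_limit x (t : U) : rapidly_complete -> regular_path x ->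
  0 < val t -> exists l, left_limit_at x t l.
Proof.
move=> dc rx t0.
have ex n : exists a, 0 <= a < val t /\ forall p q : U, a <= val p < val t ->
    a <= val q < val t -> (d (x p) (x q) <= (hpow n.+1)%:E)%E.
  by have [a a0 ha] := regular_left_cauchy rx t0 (hpow_gt0 R n.+1); exists a.
have [a ha] := boolp.choice ex.
pose A n := \big[Num.max/0]_(i < n.+1) a i.
have A0 n : 0 <= A n by exact: bigmax_ge_id.
have At n : A n < val t by apply: bigmax_lt => // i _; have [/andP[]] := ha i.
have aA n m : (n <= m)%N -> a n <= A m.
  by rewrite -ltnS => nm; exact: (le_bigmax _ _ (Ordinal nm)).
have AE n : val (clamp (A n)) = A n.
  by rewrite clampE// A0 (le_trans (ltW (At n)))// val_unitI_le1.
have [|l hl] := dc (fun n => x (clamp (A n))).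
  move=> n; apply: (@le_lt_trans _ _ (hpow n.+1)%:E).
    by apply: (ha n).2; rewrite AE At andbT aA.
  by rewrite lte_fin [ltRHS]hpowS; have := hpow_gt0 R n.+1; lra.
exists l => e e0; have [n ne] := @hpow_small R (e / 4) ltac:(by rewrite divr_gt0).
exists (val t - A n) => [|s /andP[ts st]]; first by rewrite subr_gt0.
have sx : (d (x (clamp (A n))) (x s) <= (hpow n)%:E)%E.
  apply: edist_le_weaken (hpow_anti R (leqnSn n)) _.
  apply: (ha n).2; first by rewrite AE At andbT aA.
  by rewrite st andbT (le_trans (aA n n _))//; lra.
apply: (edist_le_weaken _ (edist_triangle_le (edist_sym_le (hl n)) sx)).
by lra.
Qed.

(** One sample per piece of an adapted partition, and the value at [1],
    suffice. *)
Lemma regular_net x e : regular_path x -> 0 < e ->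
  exists m (p : nat -> U), forall t, exists2 i, (i < m)%N &
    (d (x (p i)) (x t) <= e%:E)%E.
Proof.
move=> rx e0; have [k k0 /modulus_ltP[e' [v [w [e'e [sw h]]]]]] := rx _ e0.
exists v.+1, (fun i => clamp (w i)) => t.
have [t1|t1] := ltP (val t) 1.
  have [|i iv /andP[wt tw]] := sparse_piece sw (r := val t).
    by rewrite t1 val_unitI_ge0.
  exists i; first exact: ltnW.
  apply: edist_le_weaken (ltW e'e) _; apply: (h _ iv); last by rewrite wt tw.
  rewrite clampE; last exact: (sparse_unitI sw (ltnW iv)).
  by rewrite lexx (le_lt_trans wt tw).
exists v => //; rewrite (_ : clamp (w v) = t) ?edist_refl_le ?ltW//.
have [_ wv _ _] := sw; apply: unitI_inj; rewrite wv val_clamp1.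
by apply/eqP; rewrite eq_le t1 val_unitI_le1.
Qed.

Lemma regular_sup_lty x (g : T -> \bar R) : regular_path x ->
  (forall a, g a < +oo)%E -> (forall a b, g b <= g a + d a b)%E ->
  (ereal_sup (range (fun t => g (x t))) < +oo)%E.
Proof.
move=> rx gfin gd; have [m [p hp]] := regular_net rx (@ltr01 R).
pose M := (\big[maxe/-oo]_(i < m) g (x (p i)))%E.
have M1 : (M < +oo)%E by apply: bigmax_lt => //; rewrite ltNye.
apply: (@le_lt_trans _ _ (M + 1)%E); last by rewrite lte_add_pinfty ?ltry.
apply: ereal_sup_bound => _ [t _ <-]; have [i im hi] := hp t.
apply: (le_trans (gd (x (p i)) _)); apply: leeD => //.
exact: (le_bigmax _ _ (Ordinal im)).
Qed.

End modulus.

(** * Skorokhod distances *)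

Section skorokhod_distance.
Variables (R : realType) (T : Type) (d : T -> T -> \bar R).
Hypothesis dP : edist_axioms d.
Notation U := (unitI R).
Implicit Types (x y : U -> T) (f : U -> U) (gauge : (U -> U) -> \bar R).

Lemma skorokhod_lt gauge x y (e : R) : (skorokhod gauge d x y < e%:E)%E ->
  exists f, [/\ Lambda f, (gauge f <= e%:E)%E &
    forall t, (d (x t) (y (f t)) < e%:E)%E].
Proof.
move=> /ereal_inf_lt[_ [f Lf <-]]; rewrite gt_max => /andP[/ltW gf df].
exists f; split => // t; apply: le_lt_trans df.
by apply: ereal_sup_ubound; exists t.
Qed.

Lemma skorokhod_le gauge x y f (e : R) : Lambda f -> (gauge f <= e%:E)%E ->
  (forall t, (d (x t) (y (f t)) <= e%:E)%E) ->
  (skorokhod gauge d x y <= e%:E)%E.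
Proof.
move=> Lf gf h; apply: (@le_trans _ _ (maxe (gauge f)
    (ereal_sup (range (fun t => d (x t) (y (f t))))))).
  by apply: ereal_inf_lbound; exists f.
by rewrite ge_max gf; apply: ereal_sup_bound => _ [t _ <-].
Qed.

Lemma unifnorm_leP f (e : R) : (unifnorm f <= e%:E)%E <->
  forall t, `|val (f t) - val t| <= e.
Proof.
split=> [h t|h]; last by apply: ereal_sup_bound => _ [t _ <-]; rewrite lee_fin.
by rewrite -lee_fin; apply: le_trans h; apply: ereal_sup_ubound; exists t.
Qed.

(** A time change fixes [0] and has slopes between [expR (- c)] and [expR c], so
    the logarithmic gauge dominates the uniform one. *)
Lemma lognorm_displacement f (c : R) : Lambda f -> 0 <= c <= 1 ->
  (lognorm f <= c%:E)%E -> forall t, `|val (f t) - val t| <= expR 1 * c.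
Proof.
move=> Lf /andP[c0 c1] /(lognorm_leP _ (Lambda_lt Lf)) h t.
have [t0|t0] := leP (val t) 0.
  have {}t0 : val t = 0 by apply/eqP; rewrite eq_le t0 val_unitI_ge0.
  by rewrite (Lambda0 Lf t0) t0 subrr normr0 mulr_ge0// expR_ge0.
have /andP[] := h (clamp 0) t ltac:(by rewrite val_clamp0).
rewrite (Lambda0 Lf (val_clamp0 R)) val_clamp0 !subr0 => lo up.
have t1 := val_unitI_le1 t.
have E1 : 1 <= expR 1 :> R by rewrite -[X in X <= _]expR0 ler_expR.
have Ec : expR c * (1 - c) <= 1.
  rewrite -[X in _ <= X](mulfV (lt0r_neq0 (expR_gt0 c))) -expRN.
  by rewrite ler_pM2l ?expR_gt0// expR_ge1Dx.
have Ec1 : expR c <= expR 1 by rewrite ler_expR.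
have En : 1 - c <= expR (- c) by exact: expR_ge1Dx.
have c_le : c <= expR 1 * c by rewrite ler_peMl.
rewrite ler_norml; apply/andP; split.
  have : (1 - c) * val t <= expR (- c) * val t by rewrite ler_wpM2r// ltW.
  have : c * val t <= c by rewrite ler_piMr.
  by lra.
have : expR c * c <= expR 1 * c by rewrite ler_wpM2r.
have : (expR c - 1) * val t <= expR c - 1.
  by rewrite ler_piMr// subr_ge0 -[X in X <= _]expR0 ler_expR.
by lra.
Qed.

Lemma lognorm_gap f (c delta : R) : Lambda f -> (lognorm f <= c%:E)%E ->
  forall s s', 0 < delta -> delta < val s' - val s ->
    expR (- c) * delta < val (f s') - val (f s).
Proof.
move=> Lf /(lognorm_leP _ (Lambda_lt Lf)) h s s' d0 gap.
have /andP[+ _] := h s s' ltac:(by rewrite -subr_gt0 (lt_trans d0)).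
by apply: lt_le_trans; rewrite ltr_pM2l ?expR_gt0.
Qed.

Lemma modulus_skorokhod_lognorm x y (delta e eta : R) : 0 < delta ->
  (skorokhod (@lognorm R) d x y < eta%:E)%E ->
  (modulus d x delta < e%:E)%E ->
  (modulus d y (expR (- eta) * delta) < (e + 2 * eta)%:E)%E.
Proof.
move=> d0 /skorokhod_lt[f [Lf lf h]]; 
apply: (modulus_transfer dP Lf _ (fun t => ltW (h t))).
by move=> s s'; exact: (lognorm_gap Lf lf).
Qed.

Lemma modulus_skorokhod_unifnorm x y (delta e eta : R) :
  (skorokhod (@unifnorm R) d x y < eta%:E)%E ->
  (modulus d x delta < e%:E)%E ->
  (modulus d y (delta - 2 * eta) < (e + 2 * eta)%:E)%E.
Proof.
move=> /skorokhod_lt[f [Lf /unifnorm_leP lf h]].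
apply: (modulus_transfer dP Lf _ (fun t => ltW (h t))) => s s'.
have := lf s; have := lf s'; rewrite !ler_norml => /andP[? ?] /andP[? ?].
by lra.
Qed.

Lemma skorokhod_sup_le gauge x y (g : T -> \bar R) (eta : R) :
  (forall a b, g b <= g a + d a b)%E ->
  (skorokhod gauge d x y < eta%:E)%E ->
  (ereal_sup (range (fun t => g (y t))) <=
   ereal_sup (range (fun t => g (x t))) + eta%:E)%E.
Proof.
move=> gd /skorokhod_lt[f [Lf _ h]]; apply: ereal_sup_bound => _ [t _ <-].
have [f' _ [_ fK]] := Lambda_inv Lf.
have := ltW (h (f' t)); rewrite fK => h'.
apply: (le_trans (gd (x (f' t)) _)); apply: leeD => //.
by apply: ereal_sup_ubound; exists (f' t).
Qed.

Lemma skorokhod_unif_lognorm x y (c : R) : 0 < c <= 1 ->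
  (skorokhod (@lognorm R) d x y < c%:E)%E ->
  (skorokhod (@unifnorm R) d x y <= (expR 1 * c)%:E)%E.
Proof.
move=> /andP[c0 c1] /skorokhod_lt[f [Lf lf h]]; apply: (skorokhod_le Lf).
  apply/unifnorm_leP; apply: lognorm_displacement => //.
  by rewrite c1 ltW.
move=> t; apply: le_trans (ltW (h t)) _; rewrite lee_fin ler_peMl ?ltW//.
by rewrite -[X in X < _]expR0 ltr_expR.
Qed.

(** At distance zero, right-continuity lets one compare [x] and [y] slightly to
    the right of [t], where the small displacement of the time change cannot
    cross [t]. *)
Lemma skorokhod_eq0 gauge x y :
  (forall e : R, 0 < e -> exists2 c : R, 0 < c & forall f, Lambda f ->
    (gauge f <= c%:E)%E -> forall t, `|val (f t) - val t| <= e) ->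
  (forall t, val t < 1 -> right_continuous_at d x t) ->
  (forall t, val t < 1 -> right_continuous_at d y t) ->
  skorokhod gauge d x y = 0%E -> forall t, d (x t) (y t) = 0%E.
Proof.
move=> small rx ry xy0 t; have [dge0 _ _ _] := dP.
suff h (e : R) : 0 < e -> (d (x t) (y t) <= e%:E)%E.
  apply/eqP; rewrite eq_le dge0 andbT; apply/lee_addgt0Pr => e e0.
  by rewrite add0e h.
move=> e0; have [t1|t1] := ltP (val t) 1; last first.
  have {}t1 : val t = 1 by apply/eqP; rewrite eq_le t1 val_unitI_le1.
  have [|f [Lf _ h]] := @skorokhod_lt gauge x y e; first by rewrite xy0 lte_fin.
  have := ltW (h t); rewrite (_ : f t = t)//.
  by apply: unitI_inj; rewrite (Lambda1 Lf t1).
have e3 : 0 < e / 3 by rewrite divr_gt0.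
have [a a0 ha] := rx _ t1 _ e3; have [b b0 hb] := ry _ t1 _ e3.
pose k : R := Num.min (Num.min a b) (1 - val t).
have k0 : 0 < k by rewrite !lt_min a0 b0 subr_gt0.
have [c c0 hc] := small (k / 4) ltac:(by rewrite divr_gt0).
pose s := clamp (val t + k / 2).
have sE : val s = val t + k / 2.
  have k1 : k <= 1 - val t by rewrite ge_min lexx orbT.
  by have t0 := val_unitI_ge0 t; rewrite clampE//; apply/andP; split; lra.
have [|f [Lf lf h]] := @skorokhod_lt gauge x y (Num.min c (e / 3)).
  by rewrite xy0 lte_fin lt_min c0.
have fs : `|val (f s) - val s| <= k / 4.
  by apply: hc => //; apply: le_trans lf _; rewrite lee_fin ge_min lexx.
have ka : k <= a by rewrite !ge_min lexx.
have kb : k <= b by rewrite !ge_min lexx orbT.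
have h1 : (d (x t) (x s) <= (e / 3)%:E)%E by apply: ha; rewrite sE; lra.
have h2 : (d (x s) (y (f s)) <= (e / 3)%:E)%E.
  by apply: edist_le_weaken (ltW (h s)); rewrite ge_min lexx orbT.
have h3 : (d (y t) (y (f s)) <= (e / 3)%:E)%E.
  apply: hb; move: fs; rewrite sE ler_norml => /andP[? ?].
  by apply/andP; split; lra.
apply: (edist_le_weaken _ (edist_triangle_le dP
  (edist_triangle_le dP h1 h2) (edist_sym_le dP h3))).
by lra.
Qed.

End skorokhod_distance.

(** * Completeness *)

Section completeness.
Variables (R : realType) (T : Type) (d : T -> T -> \bar R).
Hypotheses (dP : edist_axioms d) (d_complete : rapidly_complete d).
Notation U := (unitI R).

Lemma le_hpow_limit (C a b : R) : (forall k, a <= b + C * hpow k) -> a <= b.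
Proof.
move=> h; rewrite leNgt; apply/negP => ba.
have C0 : 0 < C.
  by have := h 0%N; rewrite /hpow expr0 mulr1; lra.
have [k] := @hpow_small R ((a - b) / C) ltac:(by rewrite divr_gt0// subr_gt0).
by rewrite ltr_pdivlMr// mulrC => hk; have := h k; lra.
Qed.

Fixpoint time_comp (lam : nat -> U -> U) (n k : nat) : U -> U :=
  if k is k'.+1 then lam (n + k')%N \o time_comp lam n k' else id.

Lemma time_compS lam n k u :
  time_comp lam n k.+1 u = time_comp lam n.+1 k (lam n u).
Proof.
elim: k => [|k /= ih] /=; first by rewrite addn0.
by rewrite ih addnS -addSn.
Qed.

(** With [f_n] a time change matching [x n] to [x n.+1], the compositions of
    [f_n], ..., [f_(n+k)] converge as [k] grows to a time change [mu_n], and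
    the functions [x n \o mu_n^-1] form a uniformly rapidly Cauchy sequence.
    The control of slopes is what keeps [mu_n] strictly increasing. *)
Lemma skorokhod_rapidly_complete (x : nat -> U -> T) :
  (forall n, (skorokhod (@lognorm R) d (x n) (x n.+1) < (hpow n)%:E)%E) ->
  exists y, forall n, (skorokhod (@lognorm R) d (x n) y <= (2 * hpow n)%:E)%E.
Proof.
move=> hx; have /boolp.choice[lam hlam] := fun n => skorokhod_lt (hx n).
have L n : Lambda (lam n) by have [] := hlam n.
have lognormL n : (lognorm (lam n) <= (hpow n)%:E)%E by have [] := hlam n.
pose w := time_comp lam.
have Lw n k : Lambda (w n k).
  by elim: k => [|k ih]; [exact: Lambda_id|exact: Lambda_comp].
have [g1 gV gM g0] := @lognorm_gauge R.
have lw n k : (lognorm (w n k) <= (2 * (hpow n - hpow (n + k)%N))%:E)%E.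
  elim: k => [|k ih]; first by rewrite addn0 subrr mulr0.
  apply: (le_trans (gM _ _ (Lw n k) (L (n + k)%N))).
  apply: (le_trans (leeD ih (lognormL _))).
  by rewrite -EFinD lee_fin addnS [hpow (n + k)]hpowS; lra.
have bil n k u u' : val u < val u' ->
    expR (- (2 * hpow n)) * (val u' - val u) <= val (w n k u') - val (w n k u)
      <= expR (2 * hpow n) * (val u' - val u).
  move=> uu; apply: (lognorm_leP _ (Lambda_lt (Lw n k))).1 uu.
  apply: le_trans (lw n k) _; rewrite lee_fin.
  by have := hpow_ge0 R (n + k); lra.
have step n k u : `|val (w n k u) - val (w n k.+1 u)| <= expR 1 * hpow k.
  rewrite distrC /w /=.
  apply: (le_trans (lognorm_displacement (L _) _ (lognormL _) _)).
    by rewrite hpow_ge0 hpow_le1.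
  by rewrite ler_wpM2l ?expR_ge0// hpow_anti// leq_addl.
pose C : R := 2 * expR 1.
have lim n u : exists m : U, forall k, `|val (w n k u) - val m| <= C * hpow k.
  have [l hl] := rapid_real (step n ^~ u).
  have bd k : l - C * hpow k <= val (w n k u) <= l + C * hpow k.
    by rewrite -ler_distl.
  suff l01 : 0 <= l <= 1 by exists (clamp l) => k; rewrite clampE.
  apply/andP; split; apply: (@le_hpow_limit C) => k; have /andP[] := bd k.
    by have := val_unitI_ge0 (w n k u); lra.
  by have := val_unitI_le1 (w n k u); lra.
have /boolp.choice[mu0 hmu0] := fun p : nat * U => lim p.1 p.2.
pose mu n u := mu0 (n, u).
have hmu n u k : `|val (w n k u) - val (mu n u)| <= C * hpow k.
  exact: hmu0 (n, u) k.
have muE n u (a : R) : (forall k, val (w n k u) = a) -> val (mu n u) = a.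
  move=> wa; have bd k : a - C * hpow k <= val (mu n u) <= a + C * hpow k.
    by rewrite -ler_distl; have := hmu n u k; rewrite wa distrC.
  apply/eqP; rewrite eq_le; apply/andP; split;
    by apply: (@le_hpow_limit C) => k; have /andP[] := bd k; lra.
have Lmu n : Lambda (mu n) /\ (lognorm (mu n) <= (2 * hpow n)%:E)%E.
  apply: Lambda_bilipschitz.
  - by apply: muE => k; exact: Lambda0 (Lw n k) (val_clamp0 R).
  - by apply: muE => k; exact: Lambda1 (Lw n k) (val_clamp1 R).
  - move=> u u' uu.
    apply/andP; split; apply: (@le_hpow_limit (2 * C)) => k;
    have /andP[] := bil n k _ _ uu; have := hmu n u k; have := hmu n u' k;
    rewrite !ler_norml => /andP[? ?] /andP[? ?]; lra.
have mu_lam n u : mu n u = mu n.+1 (lam n u).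
  apply: unitI_inj; apply/eqP; rewrite eq_le.
  apply/andP; split; apply: (@le_hpow_limit (2 * C)) => k;
  have := hmu n u k.+1; have := hmu n.+1 (lam n u) k;
  have := hpow_anti R (leqnSn k); rewrite /w time_compS => h;
  have : C * hpow k.+1 <= C * hpow k by rewrite ler_wpM2l// mulr_ge0 ?expR_ge0.
    by move=> ?; rewrite !ler_norml => /andP[? ?] /andP[? ?]; lra.
  by move=> ?; rewrite !ler_norml => /andP[? ?] /andP[? ?]; lra.
have /boolp.choice[nu hnu] n : exists nu,
    cancel (mu n) nu /\ cancel nu (mu n).
  by have [nu _ nuK] := Lambda_inv (Lmu n).1; exists nu.
have cauchy t n : (d (x n (nu n t)) (x n.+1 (nu n.+1 t)) < (hpow n)%:E)%E.
  have -> : nu n.+1 t = lam n (nu n t).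
    by rewrite -{1}[t](hnu n).2 mu_lam (hnu n.+1).1.
  by have [_ _] := hlam n.
have /boolp.choice[y hy] := fun t => d_complete (cauchy t).
exists y => n; apply: (skorokhod_le (Lmu n).1 (Lmu n).2) => t.
by have := hy (mu n t) n; rewrite (hnu n).1.
Qed.

(** A Skorokhod limit inherits regularity because the logarithmic gauge shrinks
    the mesh of a partition by at most a constant factor. *)
Lemma skorokhod_limit_regular (x : nat -> U -> T) y :
  (forall n, regular_path d (x n)) ->
  (forall n, (skorokhod (@lognorm R) d (x n) y <= (2 * hpow n)%:E)%E) ->
  regular_path d y.
Proof.
move=> rx xy e e0; have [n ne] := @hpow_small R (e / 8) ltac:(by rewrite divr_gt0).
have [k k0 hk] := rx n (e / 4) ltac:(by rewrite divr_gt0).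
exists (expR (- (e / 4)) * k); first by rewrite mulr_gt0 ?expR_gt0.
have xye : (skorokhod (@lognorm R) d (x n) y < (e / 4)%:E)%E.
  by apply: le_lt_trans (xy n) _; rewrite lte_fin; lra.
apply: (lt_le_trans (modulus_skorokhod_lognorm dP k0 xye hk)).
by rewrite lee_fin; lra.
Qed.

End completeness.

(** * Total boundedness *)

Section ultrafilters.
Variable R : realType.

Lemma ultra_map (X Y : Type) (f : X -> Y) (F : set_system X) :
  UltraFilter F -> UltraFilter (f @ F).
Proof.
move=> FU; split; first exact: fmap_proper_filter.
move=> G GP FG; apply/seteqP; split => B; last exact: FG.
move=> GB; have [//|FnB] := in_ultra_setVsetC (f @^-1` B) FU.
by have [y []] := filter_ex (filterI GB (FG (~` B) FnB)).
Qed.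

Lemma filter_all_lt (X : Type) (F : set_system X) (P : nat -> set X) n :
  Filter F -> (forall i, (i < n)%N -> F (P i)) ->
  F [set x | forall i, (i < n)%N -> P i x].
Proof.
move=> FF; elim: n => [|n ih] h; first by apply: filterE.
have Fn := ih (fun i iN => h i (ltnW iN)).
apply: filterS (filterI Fn (h n (ltnSn n))) => x [hx hn] i.
rewrite ltnS leq_eqVlt => /orP[/eqP->//|].
exact: hx.
Qed.

Lemma ultra_bounded_nat (X : Type) (F : set_system X) (V : X -> nat) N :
  UltraFilter F -> F [set x | (V x < N)%N] ->
  exists v, F [set x | V x = v].
Proof.
move=> FU; elim: N => [|N ih] h; first by have [x] := filter_ex h.
have [hN|hN] := in_ultra_setVsetC [set x | V x = N] FU; first by exists N.
apply: ih; apply: filterS (filterI h hN) => x [/= + /eqP].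
by rewrite ltnS leq_eqVlt => /orP[/eqP->|//]; rewrite eqxx.
Qed.

(** Total boundedness tested on ultrafilters: this composes with maps into
    totally bounded spaces, so that finitely many parameters of a point can be
    localised one after the other. *)
Definition totally_bounded (X : Type) (D : X -> X -> \bar R) (A : set X) :=
  forall F : set_system X, UltraFilter F -> F A ->
  forall e : R, 0 < e -> exists z, F [set w | (D z w <= e%:E)%E].

Lemma totally_bounded_itv (a : R) :
  totally_bounded (fun r s : R => `|r - s|%:E) [set r | - a <= r <= a].
Proof.
move=> F FU FA e e0.
have := @segment_compact R (- a) a; rewrite compact_ultra => /(_ F FU).
case=> [|p [_ /= Fp]].
  by apply: filterS FA => r /= ra; rewrite in_itv.
exists p; have := Fp _ (nbhsx_ballx p e e0); apply: filterS => w /ltW.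
by rewrite /= lee_fin.
Qed.

Lemma totally_bounded_sequence (X : Type) (D : X -> X -> \bar R) (A : set X)
    (F : set_system X) : edist_axioms D -> totally_bounded D A ->
  UltraFilter F -> F A ->
  exists z : nat -> X, forall n, F [set w | (D (z n) w <= (hpow n.+2)%:E)%E] /\
    (D (z n) (z n.+1) < (hpow n)%:E)%E.
Proof.
move=> DP tb FU FA.
have /boolp.choice[z hz] := fun n => tb F FU FA _ (hpow_gt0 R n.+2).
exists z => n; split; first exact: hz.
have [w [/= h1 h2]] := filter_ex (filterI (hz n) (hz n.+1)).
apply: le_lt_trans (edist_triangle_le DP h1 (edist_sym_le DP h2)) _.
rewrite lte_fin; have := hpow_gt0 R n.+3; rewrite [hpow n]hpowS [hpow n.+1]hpowS.
by rewrite [hpow n.+2]hpowS; lra.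
Qed.

End ultrafilters.

Section skorokhod_totally_bounded.
Variables (R : realType) (T : Type) (d : T -> T -> \bar R).
Hypothesis dP : edist_axioms d.
Notation U := (unitI R).

(** The polygonal time change matches the partitions, and its slopes are near
    [1] because the mesh is coarse compared with the displacement of the
    points. *)
Lemma adapted_close (x y : U -> T) (delta c kappa e1 e2 : R) v
    (t s : nat -> R) :
  0 < delta -> 0 < c -> 0 <= e1 -> 0 <= e2 -> 2 * e1 + e2 <= c ->
  2 * kappa <= c / (1 + c) * delta ->
  adapted d x delta e1 v t -> adapted d y delta e1 v s ->
  (forall i, (i <= v)%N -> `|t i - s i| <= kappa) ->
  (forall i, (i <= v)%N ->
    (d (x (clamp (t i))) (y (clamp (s i))) <= e2%:E)%E) ->
  (skorokhod (@lognorm R) d x y <= c%:E)%E.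
Proof.
move=> delta0 c0 e10 e20 e12 hk [st hx] [ss hy] ts xy.
have c1 : 0 < 1 + c by lra.
have Ec : 1 + c <= expR c by exact: expR_ge1Dx.
have rho1 : c / (1 + c) = 1 - (1 + c)^-1.
  by rewrite -[X in X / _](addrK 1 c) [c + 1]addrC mulrBl divff ?gt_eqF// mul1r.
have rho2 : c / (1 + c) <= c by rewrite ler_pdivrMr// ler_peMr; lra.
have En : expR (- c) <= (1 + c)^-1 by rewrite expRN lef_pV2 ?posrE ?expR_gt0.
have [i iv|f [Lf lf ft]] := partition_interpolation (c := c) st ss.
  have [_ _ _ /(_ _ iv) gap] := st.
  have rg : c / (1 + c) * delta <= c / (1 + c) * (t i.+1 - t i).
    by rewrite ler_wpM2l ?divr_ge0 ?ltW.
  have g0 : 0 <= t i.+1 - t i by rewrite ltW// (lt_trans delta0).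
  have := ts _ iv; have := ts _ (ltnW iv).
  rewrite !ler_norml => /andP[? ?] /andP[? ?]; apply/andP; split.
    apply: (@le_trans _ _ ((1 - c / (1 + c)) * (t i.+1 - t i))); last by lra.
    by rewrite ler_wpM2r// rho1; lra.
  apply: (@le_trans _ _ ((1 + c / (1 + c)) * (t i.+1 - t i))); first by lra.
  by rewrite ler_wpM2r//; lra.
apply: (skorokhod_le Lf lf) => u.
have [u1|u1] := ltP (val u) 1; last first.
  have {}u1 : val u = 1 by apply/eqP; rewrite eq_le u1 val_unitI_le1.
  have [_ tv _ _] := st; have [_ sv _ _] := ss.
  have := xy v (leqnn _); rewrite tv sv.
  rewrite (_ : f u = clamp 1); last first.
    by apply: unitI_inj; rewrite (Lambda1 Lf u1) val_clamp1.
  rewrite (_ : u = clamp 1); last by apply: unitI_inj; rewrite u1 val_clamp1.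
  by apply: edist_le_weaken; lra.
have [|i iv /andP[tu ut]] := sparse_piece st (r := val u).
  by rewrite u1 val_unitI_ge0.
have /andP[sf fs] := ft i u iv ltac:(by rewrite tu).
have tE : val (clamp (t i)) = t i by rewrite clampE// (sparse_unitI st)// ltnW.
have sE : val (clamp (s i)) = s i by rewrite clampE// (sparse_unitI ss)// ltnW.
have h1 : (d (x u) (x (clamp (t i))) <= e1%:E)%E.
  by apply: (hx _ iv); rewrite ?tE ?tu// lexx (le_lt_trans tu).
have h2 : (d (y (clamp (s i))) (y (f u)) <= e1%:E)%E.
  by apply: (hy _ iv); rewrite ?sE ?sf// lexx (le_lt_trans sf).
apply: (edist_le_weaken _ (edist_triangle_le dP
  (edist_triangle_le dP h1 (xy _ (ltnW iv))) h2)).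
by lra.
Qed.

(** Along an ultrafilter, the number of points of an adapted partition is
    eventually constant, being at most [delta^-1], and then each point and each
    value there is eventually confined to a small set; members of the
    ultrafilter so confined are close to each other by [adapted_close]. *)
Lemma skorokhod_totally_bounded (X : Type) (ev : X -> U -> T) (A : set X)
    (K : set T) :
  totally_bounded d K -> (forall x, A x -> forall t, K (ev x t)) ->
  (forall e : R, 0 < e -> exists2 delta : R, 0 < delta & forall x, A x ->
    (modulus d (ev x) delta < e%:E)%E) ->
  totally_bounded (fun x y => skorokhod (@lognorm R) d (ev x) (ev y)) A.
Proof.
move=> tbK evK emod F FU FA e e0.
have [delta delta0 hdelta] := emod (e / 4) ltac:(by rewrite divr_gt0).
have /boolp.choice[w hw] : forall x, exists w : nat * (nat -> R),
    A x -> adapted d (ev x) delta (e / 4) w.1 w.2.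
  move=> x; have [Ax|nAx] := pselect (A x); last by exists (0%N, fun=> 0).
  have /modulus_ltP[e' [v [t [e'e [st h]]]]] := hdelta x Ax.
  exists (v, t) => _; split => // i iv p q hp hq.
  exact: edist_le_weaken (ltW e'e) (h i iv p q hp hq).
pose V x := (w x).1; pose tau x := (w x).2.
have {}hw x : A x -> adapted d (ev x) delta (e / 4) (V x) (tau x) by exact: hw.
have Vbound x : A x -> (V x < (Num.truncn delta^-1).+1)%N.
  move=> /hw[[t0 tv ti gap] _]; rewrite ltnS leqNgt; apply/negP => hV.
  have lin i : (i <= V x)%N -> i%:R * delta <= tau x i.
    elim: i => [|i ih] iV; first by rewrite mul0r t0.
    have := ih (ltnW iV); have := gap _ iV; rewrite -natr1 mulrDl mul1r.
    by lra.
  have := lin _ (leqnn _); rewrite tv => Vd.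
  have : delta^-1 < (V x)%:R :> R.
    by apply: lt_le_trans (truncnS_gt _) _; rewrite ler_nat.
  by rewrite -(ltr_pM2r delta0) mulVf ?gt_eqF// ltNge Vd.
have [v Fv] : exists v, F [set x | V x = v].
  by apply: (ultra_bounded_nat FU); apply: filterS FA; exact: Vbound.
(* Two points within [kappa] of a third are within [2 * kappa] of each other,
   and [adapted_close] doubles this again. *)
pose kappa := e / (1 + e) * delta / 4.
have kappa0 : 0 < kappa by rewrite divr_gt0// mulr_gt0// divr_gt0// addr_gt0.
have FAv : F [set x | A x /\ V x = v] by exact: filterI.
have loc_t i : (i < v.+1)%N -> exists r, F [set x | `|r - tau x i| <= kappa].
  move=> iv.
  have Fi : F [set x | - 1 <= tau x i <= 1].
    apply: filterS FAv => x /= [Ax Vx]; have [st _] := hw x Ax.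
    have := @sparse_unitI R _ _ _ i st; rewrite Vx => /(_ iv)/andP[? ?].
    by apply/andP; split; lra.
  have [r Fr] : exists r, F [set x | (`|r - tau x i|%:E <= kappa%:E)%E].
    exact: (@totally_bounded_itv R 1 _ (ultra_map (tau ^~ i) FU) Fi).
  by exists r; apply: filterS Fr => x /=; rewrite lee_fin.
have loc_x i : (i < v.+1)%N ->
    exists z, F [set x | (d z (ev x (clamp (tau x i))) <= (e / 8)%:E)%E].
  move=> iv; have e8 : 0 < e / 8 by rewrite divr_gt0.
  have Fi : F [set x | K (ev x (clamp (tau x i)))].
    by apply: filterS FA => x Ax; exact: evK.
  exact: (tbK _ (ultra_map (fun x => ev x (clamp (tau x i))) FU) Fi).
have loc i : exists rz : R * T, (i < v.+1)%N ->
    F [set x | `|rz.1 - tau x i| <= kappa /\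
      (d rz.2 (ev x (clamp (tau x i))) <= (e / 8)%:E)%E].
  have [iv|_] := ltnP i v.+1.
    have [r hr] := loc_t i iv; have [z hz] := loc_x i iv.
    by exists (r, z) => _; exact: filterI.
  have [x0 _] := filter_ex FA.
  by exists (0, ev x0 (clamp 0)).
have /boolp.choice[rz hrz] := loc.
have FF : Filter F by exact: _.
have Fall := @filterI _ F FF _ _ FAv (filter_all_lt FF hrz).
have [x [[Ax Vx] hx]] := filter_ex Fall.
exists x; apply: filterS Fall => y [[Ay Vy] hy].
have := hw _ Ax; have := hw _ Ay; rewrite Vx Vy => wy wx.
apply: (adapted_close (kappa := 2 * kappa) (e2 := e / 4) delta0 e0 _ _ _ _ wx wy).
- by lra.
- by lra.
- by lra.
- by rewrite /kappa; lra.
- move=> i; rewrite -ltnS => iv.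
  have [h1 _] := hx i iv; have [h2 _] := hy i iv.
  apply: (le_trans (ler_distD (rz i).1 _ _)).
  by rewrite distrC; apply: (le_trans (lerD h1 h2)); lra.
- move=> i; rewrite -ltnS => iv.
  have [_ h1] := hx i iv; have [_ h2] := hy i iv.
  apply: (edist_le_weaken _ (edist_triangle_le dP (edist_sym_le dP h1) h2)).
  by lra.
Qed.

End skorokhod_totally_bounded.

(** * Right-continuity and left limits *)

Section cadlag.
Variables (R : realType) (T : pseudoMetricType R) (d : T -> T -> \bar R).
Hypothesis dP : edist_axioms d.
Hypothesis ballE : forall (x : T) (e : R) (y : T),
  ball x e y <-> (d x y < e%:E)%E.
Notation U := (unitI R).

Lemma nbhs_unitI (t : U) (P : set U) : nbhs t P <->
  exists2 e : R, 0 < e & forall u : U, `|val t - val u| < e -> P u.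
Proof.
split=> [/nbhs_ballP[e /= e0 h]|[e e0]]; last exact: unitI_near.
by exists e => // u; exact: h.
Qed.

Lemma cvg_edist (F : set_system U) (x : U -> T) (l : T) : Filter F ->
  x s @[s --> F] --> l <->
  forall e : R, 0 < e -> F [set s | (d l (x s) <= e%:E)%E].
Proof.
move=> FF; split=> [/cvg_ballP h e e0|h].
  by apply: filterS (h e e0) => s /= /ballE/ltW.
apply/cvg_ballP => e e0; suff : F [set s | ball l e (x s)] by [].
have e2 : 0 < e / 2 by rewrite divr_gt0.
apply: filterS (h _ e2) => s /= hs.
apply/ballE; apply: le_lt_trans hs _; rewrite lte_fin.
by lra.
Qed.

Lemma right_contP (x : U -> T) : right_cont x <->
  forall t : U, val t < 1 -> right_continuous_at d x t.
Proof.
split=> h t t1.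
  move=> e e0; have /cvg_edist/(_ e e0) := h t t1.
  rewrite /within/= => /nbhs_unitI[k k0 hk]; exists k => // s.
  rewrite le_eqVlt => /andP[/orP[/eqP/unitI_inj->|ts] sk].
    exact/edist_refl_le/ltW.
  apply: hk => //; rewrite distrC gtr0_norm ?subr_gt0//.
  by rewrite ltrBlDl.
apply/cvg_edist => e e0; have [k k0 hk] := h t t1 e e0.
apply/nbhs_unitI; exists k => // s ts ltts; apply: hk; rewrite ltW//=.
by move: ts; rewrite distrC gtr0_norm ?subr_gt0// ltrBlDl.
Qed.

Lemma left_limitsP (x : U -> T) : left_limits x <->
  forall t : U, 0 < val t -> exists l, left_limit_at d x t l.
Proof.
split=> h t t1; have [l hl] := h t t1; exists l.
  move=> e e0; have /cvg_edist/(_ e e0) := hl.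
  rewrite /within/= => /nbhs_unitI[k k0 hk]; exists k => // s /andP[ks st].
  by apply: hk => //; rewrite gtr0_norm ?subr_gt0// ltrBlDl -ltrBlDr.
apply/cvg_edist => e e0; have [k k0 hk] := hl e e0.
apply/nbhs_unitI; exists k => // s ts ltts; apply: hk; rewrite ltts andbT.
by move: ts; rewrite gtr0_norm ?subr_gt0// ltrBlDl -ltrBlDr.
Qed.

Lemma cadlagP (x : U -> T) : rapidly_complete d ->
  right_cont x /\ left_limits x <-> regular_path d x.
Proof.
move=> dc; split=> [[/right_contP rc /left_limitsP ll]|rx].
  exact: cadlag_regular.
split; first by apply/right_contP => t; exact: regular_right_continuous.
by apply/left_limitsP => t; exact: regular_left_limit.
Qed.

End cadlag.

(** * Compact sets of functions with values in D *)

Section DR_theory.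
Variable R : realType.
Notation U := (unitI R).
Notation absd := (fun a b : R => `|a - b|%:E).

Lemma abs_ballE (x e y : R) : ball x e y <-> (`|x - y|%:E < e%:E)%E.
Proof. by rewrite lte_fin. Qed.

Lemma abs_rapidly_complete : rapidly_complete absd.
Proof.
move=> u hu; have [|l hl] := @rapid_real R 1 u.
  by move=> n; have := ltW (hu n); rewrite lee_fin mul1r.
by exists l => n; have := hl n; rewrite lee_fin mulr1.
Qed.

Lemma DR_regular (z : DR R) : regular_path absd z.
Proof.
apply/(cadlagP (@abs_edist R) abs_ballE _ abs_rapidly_complete).
by split; [exact: DR_right_cont|exact: DR_left_limits].
Qed.

Lemma regular_DR (y : U -> R) :
  regular_path absd y -> exists z : DR R, DR_fun z = y.
Proof.
move=> /(cadlagP (@abs_edist R) abs_ballE _ abs_rapidly_complete)[rc ll].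
by exists (MkDR rc ll).
Qed.

Lemma dJ1_rapidly_complete : rapidly_complete (@dJ1 R).
Proof.
move=> u hu.
have [y hy] := skorokhod_rapidly_complete abs_rapidly_complete hu.
have [|z zy] := @regular_DR y.
  apply: (skorokhod_limit_regular (@abs_edist R) _ hy) => n; exact: DR_regular.
by exists z => n; rewrite /dJ1 zy.
Qed.

Lemma DDR_regular (x : DDR R) : regular_path (@dJ1 R) x.
Proof.
apply/(cadlagP (@dJ1_edist R) _ _ dJ1_rapidly_complete) => //.
by split; [exact: DDR_right_cont|exact: DDR_left_limits].
Qed.

Lemma regular_DDR (y : U -> DR R) :
  regular_path (@dJ1 R) y -> exists z : DDR R, DDR_fun z = y.
Proof.
have ballE (x : DR R) (e : R) (z : DR R) :
  ball x e z <-> (dJ1 x z < e%:E)%E by [].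
move=> /(cadlagP (@dJ1_edist R) ballE _ dJ1_rapidly_complete)[rc ll].
by exists (MkDDR rc ll).
Qed.

Lemma lognorm_small (e : R) : 0 < e -> exists2 c : R, 0 < c &
  forall f : U -> U, Lambda f -> (lognorm f <= c%:E)%E ->
  forall t, `|val (f t) - val t| <= e.
Proof.
move=> e0; exists (Num.min 1 (e / expR 1)).
  by rewrite lt_min ltr01 divr_gt0// expR_gt0.
move=> f Lf lf t; apply: (le_trans (lognorm_displacement Lf _ lf t)).
  by rewrite ge_min lexx andbT le_min ler01 divr_ge0 ?expR_ge0 ?ltW.
by rewrite mulrC -ler_pdivlMr ?expR_gt0// ge_min lexx orbT.
Qed.

Lemma dJ1_eq0 (x y : DR R) : dJ1 x y = 0%E -> x = y.
Proof.
move=> xy0.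
have rc (z : DR R) (t : U) : val t < 1 -> right_continuous_at absd z t.
  by apply: regular_right_continuous; exact: DR_regular.
have h := skorokhod_eq0 (@abs_edist R) lognorm_small (rc x) (rc y) xy0.
have {h} : DR_fun x = DR_fun y.
  apply: funext => t; have [] := h t => /eqP.
  by rewrite normr_eq0 subr_eq0 => /eqP.
clear xy0; case: x y => [x xr xl] [y yr yl] /= xy; subst y.
by congr MkDR; exact: Prop_irrelevance.
Qed.

Lemma dDD_eq0 (x y : DDR R) : dDD x y = 0%E -> x = y.
Proof.
move=> xy0.
have rc (z : DDR R) (t : U) : val t < 1 -> right_continuous_at (@dJ1 R) z t.
  by apply: regular_right_continuous; exact: DDR_regular.
have small (e : R) : 0 < e -> exists2 c : R, 0 < c &
    forall f : U -> U, Lambda f -> (unifnorm f <= c%:E)%E ->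
    forall t, `|val (f t) - val t| <= e.
  by move=> e0; exists e => // f _ /unifnorm_leP.
have h := skorokhod_eq0 (@dJ1_edist R) small (rc x) (rc y) xy0.
have {h} : DDR_fun x = DDR_fun y by apply: funext => t; exact/dJ1_eq0.
clear xy0; case: x y => [x xr xl] [y yr yl] /= xy; subst y.
by congr MkDDR; exact: Prop_irrelevance.
Qed.

Lemma nbhs_dDD (x : DDR R) (B : set (DDR R)) : nbhs x B <->
  exists2 e : R, 0 < e & forall y, (dDD x y < e%:E)%E -> B y.
Proof.
split=> [/nbhs_ballP[e /= e0 h]|[e e0 h]]; first by exists e => // y; exact: h.
by apply/nbhs_ballP; exists e => //= y; exact: h.
Qed.

Lemma hausdorff_DDR : hausdorff_space (DDR R).
Proof.
move=> x y xy; apply: dDD_eq0; have [d0 _ _ _] := @dDD_edist R.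
apply/eqP; rewrite eq_le d0 andbT; apply/lee_addgt0Pr => e e0; rewrite add0e.
have e2 : 0 < e / 2 by rewrite divr_gt0.
have [z [/= /ltW xz /ltW yz]] := xy _ _ (nbhsx_ballx x _ e2) (nbhsx_ballx y _ e2).
apply: edist_le_weaken (edist_triangle_le (@dDD_edist R) xz
  (edist_sym_le (@dDD_edist R) yz)).
by lra.
Qed.

Lemma normD_ge0 (z : DR R) : (0 <= normD z)%E.
Proof.
apply: (@le_trans _ _ `|z (clamp 0)|%:E); first by rewrite lee_fin.
by apply: ereal_sup_ubound; exists (clamp 0).
Qed.

Lemma abs_le_abs (a b : R) : (`|b|%:E <= `|a|%:E + `|a - b|%:E)%E.
Proof.
rewrite -EFinD lee_fin -lerBlDl distrC.
exact: lerB_dist.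
Qed.

Lemma normD_dJ1 (y z : DR R) : (normD z <= normD y + dJ1 y z)%E.
Proof.
have [d0 _ _ _] := @dJ1_edist R.
have [->|dfin] := eqVneq (dJ1 y z) +oo%E.
  by rewrite addey ?leey// -ltNye (lt_le_trans _ (normD_ge0 y)).
apply/lee_addgt0Pr => e e0; rewrite -addeA.
have df : dJ1 y z \is a fin_num by rewrite ge0_fin_numE// ltey.
rewrite -(fineK df) -EFinD.
apply: (skorokhod_sup_le (gauge := @lognorm R) (g := fun a : R => `|a|%:E)
  abs_le_abs).
rewrite -[skorokhod _ _ _ _]/(dJ1 y z) -(fineK df) lte_fin.
by rewrite ltrDl.
Qed.

Lemma normD_lty (z : DR R) : (normD z < +oo)%E.
Proof.
apply: (regular_sup_lty (g := fun a : R => `|a|%:E) (@abs_edist R)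
  (DR_regular z)).
  by move=> a; rewrite ltry.
exact: abs_le_abs.
Qed.

Lemma normDD_lty (x : DDR R) : (normDD x < +oo)%E.
Proof.
exact: (regular_sup_lty (@dJ1_edist R) (DDR_regular x) normD_lty normD_dJ1).
Qed.

Lemma normDD_dDD (x y : DDR R) (eta : R) : (dDD x y < eta%:E)%E ->
  (normDD y <= normDD x + eta%:E)%E.
Proof. by move=> h; exact: (skorokhod_sup_le normD_dJ1 h). Qed.

Lemma wD_dDD (x y : DDR R) (delta e eta : R) : 0 < delta ->
  (dDD x y < eta%:E)%E -> (forall t, (wD (x t) delta < e%:E)%E) ->
  forall t, (wD (y t) (expR (- eta) * delta) < (e + 2 * eta)%:E)%E.
Proof.
move=> d0 /skorokhod_lt[f [Lf _ h]] hx t.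
have [f' _ [_ fK]] := Lambda_inv Lf; have := h (f' t); rewrite fK => ht.
exact: (modulus_skorokhod_lognorm (@abs_edist R) d0 ht (hx _)).
Qed.

Lemma wDD_dDD (x y : DDR R) (delta e eta : R) :
  (dDD x y < eta%:E)%E -> (wDD x delta < e%:E)%E ->
  (wDD y (delta - 2 * eta) < (e + 2 * eta)%:E)%E.
Proof. by move=> xy; exact: (modulus_skorokhod_unifnorm (@dJ1_edist R) xy). Qed.

(** The values of [x] are totally bounded, and a bound on the modulus passes to
    nearby functions at a slightly smaller [delta], so finitely many values
    decide. *)
Lemma wD_uniform (x : DDR R) (e : R) : 0 < e ->
  exists2 delta : R, 0 < delta & forall t, (wD (x t) delta < e%:E)%E.
Proof.
move=> e0; have e8 : 0 < e / 8 by rewrite divr_gt0.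
have [m [p hp]] := regular_net (@dJ1_edist R) (DDR_regular x) e8.
have [||k k0 hk] := @finite_common R m
    (fun i k => (wD (x (p i)) k < (e / 4)%:E)%E).
- move=> i a b ab; apply: le_lt_trans; exact: modulus_anti.
- by move=> i _; apply: DR_regular; rewrite divr_gt0.
exists (expR (- (e / 4)) * k); first by rewrite mulr_gt0 ?expR_gt0.
move=> t; have [i im hi] := hp t.
have hi' : (dJ1 (x (p i)) (x t) < (e / 4)%:E)%E.
  by apply: le_lt_trans hi _; rewrite lte_fin; lra.
apply: (lt_le_trans (modulus_skorokhod_lognorm (@abs_edist R) k0 hi'
  (hk _ im))).
by rewrite lee_fin; lra.
Qed.

Lemma open_normDD_lt (a : R) : open [set x : DDR R | (normDD x < a%:E)%E].
Proof.
rewrite openE => x /= xa; apply/nbhs_dDD.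
have n0 : (0 <= normDD x)%E.
  apply: le_trans (normD_ge0 (x (clamp 0))) _.
  by apply: ereal_sup_ubound; exists (clamp 0).
have nf : normDD x \is a fin_num by rewrite ge0_fin_numE// normDD_lty.
move: xa; rewrite -(fineK nf) lte_fin => xa.
exists ((a - fine (normDD x)) / 2); first by rewrite divr_gt0// subr_gt0.
move=> y /normDD_dDD/le_lt_trans; apply.
by rewrite -(fineK nf) -EFinD lte_fin; lra.
Qed.

Lemma open_wDD_lt (delta e : R) : open [set x : DDR R | (wDD x delta < e%:E)%E].
Proof.
rewrite openE => x /= /modulus_slack[delta' [e' [dd ee h]]]; apply/nbhs_dDD.
pose eta : R := Num.min ((delta' - delta) / 2) ((e - e') / 2).
exists eta; first by rewrite lt_min !divr_gt0// subr_gt0.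
have h1 : eta <= (delta' - delta) / 2 by rewrite ge_min lexx.
have h2 : eta <= (e - e') / 2 by rewrite ge_min lexx orbT.
move=> y xy; have hy := wDD_dDD xy h.
apply: (@le_lt_trans _ _ (wDD y (delta' - 2 * eta))).
  by apply: modulus_anti; lra.
by apply: lt_le_trans hy _; rewrite lee_fin; lra.
Qed.

(** The hypotheses of the Arzela-Ascoli theorem for the two-level space. *)
Definition equiregular (A : set (DDR R)) :=
  [/\ exists a : R, forall x, A x -> (normDD x <= a%:E)%E,
      forall e : R, 0 < e -> exists2 delta : R, 0 < delta &
        forall x, A x -> forall t, (wD (x t) delta < e%:E)%E
    & forall e : R, 0 < e -> exists2 delta : R, 0 < delta &
        forall x, A x -> (wDD x delta < e%:E)%E].

(** Each bound passes to nearby functions, at the cost of a smaller [delta] and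
    a larger [e]. *)
Lemma equiregular_closure A : equiregular A -> equiregular (closure A).
Proof.
move=> [[a ha] h1 h2].
have near_A x (e : R) : closure A x -> 0 < e ->
    exists2 y, A y & (dDD y x < e%:E)%E.
  move=> cx e0; have [y [Ay xy]] := cx _ (nbhsx_ballx x _ e0).
  have [_ _ dC _] := @dDD_edist R.
  by exists y; [exact: Ay|rewrite dC; exact: xy].
split.
- exists (a + 1) => x cx; have [y Ay yx] := near_A x 1 cx ltr01.
  apply: le_trans (normDD_dDD yx) _; rewrite EFinD.
  by apply: leeD => //; exact: ha.
- move=> e e0; have e4 : 0 < e / 4 by rewrite divr_gt0.
  have [k k0 hk] := h1 _ e4.
  exists (expR (- (e / 4)) * k); first by rewrite mulr_gt0 ?expR_gt0.
  move=> x cx t; have [y Ay yx] := near_A x _ cx e4.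
  apply: lt_le_trans (wD_dDD k0 yx (hk y Ay) t) _.
  by rewrite lee_fin; lra.
- move=> e e0; have e2 : 0 < e / 2 by rewrite divr_gt0.
  have [k k0 hk] := h2 _ e2.
  exists (k / 2); first by rewrite divr_gt0.
  move=> x cx; pose eta := Num.min (k / 4) (e / 4).
  have [|y Ay yx] := near_A x eta cx; first by rewrite lt_min !divr_gt0.
  have l1 : eta <= k / 4 by rewrite ge_min lexx.
  have l2 : eta <= e / 4 by rewrite ge_min lexx orbT.
  apply: (@le_lt_trans _ _ (wDD x (k - 2 * eta))).
    by apply: modulus_anti; lra.
  apply: lt_le_trans (wDD_dDD yx (hk y Ay)) _.
  by rewrite lee_fin; lra.
Qed.

(** Total boundedness is obtained twice from the same lemma: for the values,
    as functions into a bounded interval, and then for the functions with these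
    values. Working with the logarithmic gauge at the outer level too makes
    Cauchy sequences converge, and it gives a finer topology. *)
Lemma equiregular_compact A : equiregular A -> closed A -> compact A.
Proof.
move=> [[a ha] h1 h2] cA; rewrite compact_ultra => F FU FA.
pose K := [set z : DR R | exists2 x, A x & exists t, z = x t].
have tbK : totally_bounded (@dJ1 R) K.
  apply: (skorokhod_totally_bounded (@abs_edist R) (@totally_bounded_itv R a)).
    move=> z [x Ax [t ->]] s /=; rewrite -ler_norml -lee_fin.
    apply: le_trans (ha x Ax); apply: (@le_trans _ _ (normD (x t))).
      by apply: ereal_sup_ubound; exists s.
    by apply: ereal_sup_ubound; exists t.
  move=> e e0; have [k k0 hk] := h1 e e0; exists k => // z [x Ax [t ->]].
  exact: hk.
pose D (x y : DDR R) := skorokhod (@lognorm R) (@dJ1 R) x y.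
have DP : edist_axioms D.
  have [p1 p2 p3 p4] := skorokhod_edist (@lognorm_gauge R) (@dJ1_edist R).
  by split => *; [exact: p1|exact: p2|exact: p3|exact: p4].
have tbA : totally_bounded D A.
  apply: (skorokhod_totally_bounded (@dJ1_edist R) tbK) => //.
  by move=> x Ax t; exists x => //; exists t.
have [z hz] := totally_bounded_sequence DP tbA FU FA.
have [y hy] := skorokhod_rapidly_complete dJ1_rapidly_complete
  (fun n => (hz n).2).
have [|x xy] := @regular_DDR y.
  apply: (skorokhod_limit_regular (@dJ1_edist R) _ hy) => n; exact: DDR_regular.
have Fx : F --> x.
  move=> B /nbhs_dDD[e e0 hB].
  pose c : R := Num.min 1 (e / (2 * expR 1)).
  have c0 : 0 < c by rewrite lt_min ltr01 divr_gt0// mulr_gt0 ?expR_gt0.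
  have [n hn] := @hpow_small R (c / 4) ltac:(by rewrite divr_gt0).
  apply: filterS (hz n).1 => w /= zw; apply: hB.
  have zx : (D x (z n) <= (2 * hpow n)%:E)%E.
    by apply: (edist_sym_le DP); rewrite /D xy.
  have xw : (D x w < c%:E)%E.
    apply: le_lt_trans (edist_triangle_le DP zx zw) _; rewrite lte_fin.
    have := @hpow_anti R n n.+2 (leqW (leqnSn n)); lra.
  have c1 : 0 < c <= 1 by rewrite c0 ge_min lexx.
  apply: le_lt_trans (skorokhod_unif_lognorm c1 xw) _; rewrite lte_fin.
  apply: (@le_lt_trans _ _ (e / 2)); last by lra.
  rewrite mulrC -ler_pdivlMr ?expR_gt0// -mulrA -invfM.
  by rewrite ge_min lexx orbT.
exists x; split; last exact: Fx.
apply: cA => B /Fx FB; exact: filter_ex (filterI FA FB).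
Qed.

(** The common form of the conditions on the norm and on the two moduli, with
    [n] a large bound for the norm or [n.+1] the inverse of a small mesh. The
    neighbourhoods serve twice: they give uniformity on compact sets, and they
    provide measurable sets inside a possibly non-measurable [S n]. *)
Definition exhausting (S : nat -> set (DDR R)) :=
  (forall m n, (m <= n)%N -> S m `<=` S n) /\
  forall x : DDR R, exists n, nbhs x (S n).

(** Otherwise the sets [K `\` S n] would form a filter with a cluster point in
    [K], which has a neighbourhood inside some [S n]. *)
Lemma compact_exhausting S K : exhausting S -> compact K ->
  exists n, K `<=` S n.
Proof.
move=> [Smono Sx] cK; apply: contrapT => /forallNP h.
pose F := filter_from [set: nat] (fun n => K `\` S n).
have FF : ProperFilter F.
  apply: filter_from_proper; last first.
    move=> n _; apply: contrapT => /nonemptyPn KS; apply: (h n).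
    by rewrite -setD_eq0.
  apply: filter_from_filter; first by exists 0%N.
  move=> m n _ _; exists (maxn m n) => // x [Kx nSx].
  split; split => // Sx'; apply: nSx; apply: Smono Sx'.
    exact: leq_maxl.
  exact: leq_maxr.
have [|x [Kx clx]] := cK F FF; first by exists 0%N => // x [].
have [n Sn] := Sx x.
have [|y [[_ ?] ?]//] := clx (K `\` S n) (S n) _ Sn.
by exists n.
Qed.

Lemma exhausting_normDD :
  exhausting (fun n => [set x : DDR R | (normDD x < n%:R%:E)%E]).
Proof.
split=> [m n mn x /= /lt_le_trans|x].
  by apply; rewrite lee_fin ler_nat.
have [n xn] : exists n : nat, (normDD x < n%:R%:E)%E.
  have := normDD_lty x; case: (normDD x) => [r _|//|_]; last first.
    by exists 0%N; rewrite ltNyr.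
  by exists (Num.truncn r).+1; rewrite lte_fin truncnS_gt.
by exists n; apply: open_nbhs_nbhs; split; [exact: open_normDD_lt|exact: xn].
Qed.

Lemma invS_anti m n : (m <= n)%N -> n.+1%:R^-1 <= m.+1%:R^-1 :> R.
Proof. by move=> mn; rewrite lef_pV2 ?posrE ?ltr0n// ler_nat. Qed.

Lemma invS_small (e : R) : 0 < e -> exists n : nat, n.+1%:R^-1 <= e.
Proof.
move=> e0; exists (Num.truncn e^-1); rewrite invf_ple ?posrE ?ltr0n//.
exact/ltW/truncnS_gt.
Qed.

Lemma exhausting_wD (e : R) : 0 < e -> exhausting (fun n =>
  [set x : DDR R | forall t, (wD (x t) n.+1%:R^-1 < e%:E)%E]).
Proof.
move=> e0; split=> [m n mn x /= h t|x].
  by apply: le_lt_trans (h t); exact/modulus_anti/invS_anti.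
have e4 : 0 < e / 4 by rewrite divr_gt0.
have [k k0 hk] := wD_uniform x e4.
have k0' : 0 < expR (- (e / 4)) * k by rewrite mulr_gt0 ?expR_gt0.
have [n hn] := invS_small k0'; exists n; apply/nbhs_dDD; exists (e / 4) => //.
move=> y xy t; apply: (@le_lt_trans _ _ (wD (y t) (expR (- (e / 4)) * k))).
  exact: modulus_anti.
by apply: lt_le_trans (wD_dDD k0 xy hk t) _; rewrite lee_fin; lra.
Qed.

Lemma exhausting_wDD (e : R) : 0 < e -> exhausting (fun n =>
  [set x : DDR R | (wDD x n.+1%:R^-1 < e%:E)%E]).
Proof.
move=> e0; split=> [m n mn x /=|x].
  by apply: le_lt_trans; exact/modulus_anti/invS_anti.
have [k k0 hk] := DDR_regular x e0; have [n hn] := invS_small k0.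
exists n; apply: open_nbhs_nbhs; split; first exact: open_wDD_lt.
by apply: le_lt_trans hk; exact: modulus_anti.
Qed.

End DR_theory.

(** * Tightness *)

Section limits_of_limsup.
Variable R : realType.
Implicit Types (u : nat -> \bar R) (eta : R).

Lemma limn_esup_le u eta : (forall n, (u n <= eta%:E)%E) ->
  (limn_esup u <= eta%:E)%E.
Proof.
move=> h; apply: (@le_trans _ _ (ereal_sup (u @` setT))).
  by apply: ereal_inf_lbound; exists setT => //; exact: filterT.
by apply: ereal_sup_bound => _ [n _ <-].
Qed.

Lemma limn_esup_ge0 u : (forall n, (0 <= u n)%E) -> (0 <= limn_esup u)%E.
Proof.
move=> h; apply: limf_esup_ge0 => //; exact: filter_not_empty.
Qed.

Lemma limn_esup_lt u eta : (limn_esup u < eta%:E)%E ->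
  exists N, forall n, (N <= n)%N -> (u n <= eta%:E)%E.
Proof.
move=> /ereal_inf_lt[_ [A [N _ NA] <-] /ltW h].
exists N => n Nn; apply: le_trans h; apply: ereal_sup_ubound.
by exists n => //; exact: NA.
Qed.

Lemma cvg0_ereal (F : set_system R) (f : R -> \bar R) : Filter F ->
  (forall a, (0 <= f a)%E) ->
  f a @[a --> F] --> (0 : \bar R) <->
  forall eta, 0 < eta -> \forall a \near F, (f a <= eta%:E)%E.
Proof.
move=> FF f0; split.
  move=> /fine_cvgP[ffin /cvgrPdist_le fcvg] eta eta0.
  apply: filterS2 ffin (fcvg _ eta0) => a fa /=.
  rewrite sub0r normrN => fa_eta; rewrite -(fineK fa) lee_fin.
  exact: le_trans (ler_norm _) fa_eta.
move=> h; have le_fin a (eta : R) : (f a <= eta%:E)%E -> f a \is a fin_num.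
  by move=> fa; rewrite ge0_fin_numE// (le_lt_trans fa)// ltry.
apply/fine_cvgP; split.
  by apply: filterS (h _ ltr01) => a; exact: le_fin.
apply/cvgrPdist_le => eta eta0; apply: filterS (h _ eta0) => a fa.
rewrite sub0r normrN ger0_norm ?fine_ge0//.
by rewrite -lee_fin fineK// (le_fin _ _ fa).
Qed.

End limits_of_limsup.

Section tightness.
Variable R : realType.
Implicit Types (Q : probability (borelDDR R) R) (S : nat -> set (DDR R)).

Lemma open_measurable_DDR (A : set (DDR R)) :
  open A -> measurable (A : set (borelDDR R)).
Proof. by move=> oA; exact: sub_sigma_algebra. Qed.

Lemma outer_measurable Q (A : set (borelDDR R)) :
  measurable A -> outer Q A = Q A.
Proof. exact: measurable_mu_extE. Qed.

Lemma outer_le Q (A B : set (borelDDR R)) :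
  A `<=` B -> (outer Q A <= outer Q B)%E.
Proof. exact: le_mu_ext. Qed.

Lemma outer_ge0 Q (A : set (borelDDR R)) : (0 <= outer Q A)%E.
Proof. exact: mu_ext_ge0. Qed.

(** Outer measures are not continuous along decreasing sequences of arbitrary
    sets; here the interiors of the sets [S n] already exhaust the space. *)
Lemma exhausting_outer Q S eta : exhausting S -> 0 < eta ->
  exists m, (outer Q (~` S m) <= eta%:E)%E.
Proof.
move=> [Smono Sx] eta0.
pose C n : set (borelDDR R) := ~` ((S n)°)%classic.
have mC n : measurable (C n).
  by apply: measurableC; apply: open_measurable_DDR; exact: open_interior.
have C0 : \bigcap_n C n = set0.
  apply/seteqP; split => // x hx; have [n Sn] := Sx x.
  exact: hx n I Sn.
have cvgC : Q (C n) @[n --> \oo] --> Q (\bigcap_n C n).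
  apply: nonincreasing_cvg_mu => //.
  - by rewrite (le_lt_trans (probability_le1 _ (mC 0%N)))// ltry.
  - exact: bigcap_measurable.
  - move=> m n mn; apply/subsetPset; apply: subsetC; apply: interiorS.
    exact: Smono.
rewrite C0 measure0 in cvgC.
have /fine_cvgP[_ /cvgrPdist_le/(_ _ eta0)[N _ hN]] := cvgC.
exists N; apply: (@le_trans _ _ (outer Q (C N))).
  by apply: outer_le; apply: subsetC; exact: interior_subset.
rewrite outer_measurable//; have := hN N (leqnn _).
have fN : Q (C N) \is a fin_num.
  by rewrite ge0_fin_numE// (le_lt_trans (probability_le1 _ (mC N)))// ltry.
by rewrite /= sub0r normrN ger0_norm ?fine_ge0// -lee_fin fineK.
Qed.

Variable P : nat -> probability (borelDDR R) R.

Definition uniformly_exhausted S := forall eta : R, 0 < eta ->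
  exists m, forall n, (outer (P n) (~` S m) <= eta%:E)%E.

Lemma outer_anti Q S eta m m' : exhausting S -> (m <= m')%N ->
  (outer Q (~` S m) <= eta%:E)%E -> (outer Q (~` S m') <= eta%:E)%E.
Proof.
move=> [Smono _] mm; apply: le_trans; apply: outer_le.
by apply: subsetC; exact: Smono.
Qed.

(** The upper limit ignores finitely many measures, and each of these is
    handled separately by [exhausting_outer]. *)
Lemma limsup_uniformly_exhausted S : exhausting S ->
  (forall eta : R, 0 < eta -> exists m,
    (limn_esup (fun n => outer (P n) (~` S m)) < eta%:E)%E) ->
  uniformly_exhausted S.
Proof.
move=> eS h eta eta0; have [m0 /limn_esup_lt[N hN]] := h eta eta0.
have [m1 hm1] : exists m1, forall n, (n < N)%N ->
    (outer (P n) (~` S m1) <= eta%:E)%E.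
  elim: N {hN} => [|N [m hm]]; first by exists 0%N.
  have [m' hm'] := exhausting_outer (P N) eS eta0.
  exists (maxn m m') => n; rewrite ltnS leq_eqVlt => /orP[/eqP->|/hm].
    by apply: outer_anti hm' => //; exact: leq_maxr.
  by apply: outer_anti => //; exact: leq_maxl.
exists (maxn m0 m1) => n; have [Nn|nN] := leqP N n.
  by apply: outer_anti (hN _ Nn) => //; exact: leq_maxl.
by apply: outer_anti (hm1 _ nN) => //; exact: leq_maxr.
Qed.

Lemma uniformly_exhaustedI S S' : exhausting S -> exhausting S' ->
  uniformly_exhausted S -> uniformly_exhausted S' ->
  uniformly_exhausted (fun n => S n `&` S' n).
Proof.
move=> eS eS' h h' eta eta0; have eta2 : 0 < eta / 2 by rewrite divr_gt0.
have [m hm] := h _ eta2; have [m' hm'] := h' _ eta2.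
exists (maxn m m') => n; rewrite setCI.
apply: (le_trans (outer_measureU2 (mu_ext (P n)) _ _)).
rewrite (_ : eta%:E = (eta / 2)%:E + (eta / 2)%:E)%E; last first.
  by rewrite -EFinD -splitr.
apply: leeD.
  by apply: outer_anti (hm n) => //; exact: leq_maxl.
by apply: outer_anti (hm' n) => //; exact: leq_maxr.
Qed.

(** Compact sets are measurable because the distance separates points, so their
    complements bound the outer measures from above. *)
Lemma tight_uniformly_exhausted S :
  tight P -> exhausting S -> uniformly_exhausted S.
Proof.
move=> tP eS eta eta0; have [K [cK hK]] := tP eta eta0.
have [m Km] := compact_exhausting eS cK.
have mK : measurable (~` K : set (borelDDR R)).
  apply: open_measurable_DDR; rewrite openC.
  exact: compact_closed (@hausdorff_DDR R) cK.
exists m => n; apply: (@le_trans _ _ (outer (P n) (~` K))).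
  by apply: outer_le; exact: subsetC.
have mK' : measurable (K : set (borelDDR R)).
  by rewrite -[K]setCK; exact: measurableC.
have fK : P n K \is a fin_num by exact: fin_num_measure.
rewrite outer_measurable// probability_setC//; have := hK n.
by rewrite -(fineK fK) -EFinB !lee_fin; lra.
Qed.

(** Discarding an event of outer measure at most [eta / 2 ^ k.+1] for each
    accuracy [2 ^- k] leaves an equiregular set, whose closure is compact. *)
Lemma uniformly_exhausted_tight :
  uniformly_exhausted (fun n => [set x : DDR R | (normDD x < n%:R%:E)%E]) ->
  (forall eps : R, 0 < eps -> uniformly_exhausted (fun n =>
    [set x : DDR R | forall t, (wD (x t) n.+1%:R^-1 < eps%:E)%E])) ->
  (forall eps : R, 0 < eps -> uniformly_exhausted (fun n =>
    [set x : DDR R | (wDD x n.+1%:R^-1 < eps%:E)%E])) ->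
  tight P.
Proof.
move=> h0 h1 h2 eta eta0.
pose S0 n := [set x : DDR R | (normDD x < n%:R%:E)%E].
pose S1 k n :=
  [set x : DDR R | forall t, (wD (x t) n.+1%:R^-1 < (hpow k)%:E)%E].
pose S2 k n := [set x : DDR R | (wDD x n.+1%:R^-1 < (hpow k)%:E)%E].
have e1 k : exhausting (S1 k) by exact: exhausting_wD (hpow_gt0 R k).
have e2 k : exhausting (S2 k) by exact: exhausting_wDD (hpow_gt0 R k).
have eI (S S' : nat -> set (DDR R)) : exhausting S -> exhausting S' ->
    exhausting (fun n => S n `&` S' n).
  move=> [Sm Sx] [Sm' Sx']; split=> [m n mn x [xS xS']|x].
    by split; [exact: Sm xS|exact: Sm' xS'].
  have [n Sn] := Sx x; have [n' Sn'] := Sx' x; exists (maxn n n').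
  apply: filterS (filterI Sn Sn') => y [yS yS']; split.
    by apply: Sm yS; exact: leq_maxl.
  by apply: Sm' yS'; exact: leq_maxr.
have /boolp.choice[m hm] : forall k, exists m, forall n,
    (outer (P n) (~` (S0 m `&` (S1 k m `&` S2 k m))) <=
     (eta / (2 ^ k.+1)%:R)%:E)%E.
  move=> k; have u1 := h1 _ (hpow_gt0 R k); have u2 := h2 _ (hpow_gt0 R k).
  apply: (uniformly_exhaustedI (exhausting_normDD R) (eI _ _ (e1 k) (e2 k)) h0
    (uniformly_exhaustedI (e1 k) (e2 k) u1 u2)).
  by rewrite divr_gt0// ltr0n expn_gt0.
pose A := \bigcap_k (S0 (m k) `&` (S1 k (m k) `&` S2 k (m k))).
have invS_gt0 n : 0 < n.+1%:R^-1 :> R by rewrite invr_gt0 ltr0n.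
have eA : equiregular A.
  split.
  - by exists (m 0%N)%:R => x Ax; have [/ltW] := Ax 0%N I.
  - move=> e e0'; have [k ke] := hpow_small e0'.
    exists (m k).+1%:R^-1 => // x Ax t; have [_ [h _]] := Ax k I.
    by apply: lt_trans (h t) _; rewrite lte_fin.
  - move=> e e0'; have [k ke] := hpow_small e0'.
    exists (m k).+1%:R^-1 => // x Ax; have [_ [_ h]] := Ax k I.
    by apply: lt_trans h _; rewrite lte_fin.
have cA : closed (closure A) by exact: closed_closure.
exists (closure A); split.
  exact: equiregular_compact (equiregular_closure eA) cA.
move=> n; have mC : measurable (~` closure A : set (borelDDR R)).
  by apply: open_measurable_DDR; rewrite openC.
have small : (P n (~` closure A) <= eta%:E)%E.
  rewrite -outer_measurable//.
  apply: (@le_trans _ _ (outer (P n) (\bigcup_k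
      (~` (S0 (m k) `&` (S1 k (m k) `&` S2 k (m k))))))).
    by apply: outer_le; rewrite -setC_bigcap; apply: subsetC; exact: subset_closure.
  apply: (le_trans (outer_measure_sigma_subadditive (mu_ext (P n)) _)).
  apply: le_trans (epsilon_trick0 xpredT (ltW eta0)).
  by apply: lee_nneseries => [k _ _|k _]; [exact: outer_ge0|exact: hm].
rewrite -[closure A]setCK probability_setC// EFinB.
exact: leeB.
Qed.

(** Monotonicity in the parameter lets a filter of real parameters be replaced
    by a sequence [r]; here [B] lists the complements of the events [S]. *)
Lemma limsup_cvg0P (F : set_system R) (B : R -> set (DDR R)) S (r : nat -> R) :
  Filter F -> exhausting S ->
  (forall n, B (r n) = ~` S n) ->
  (forall m, \forall a \near F, B a `<=` ~` S m) ->
  (forall V, F V -> exists n, V (r n)) ->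
  uniformly_exhausted S <->
  limn_esup (fun n => outer (P n) (B a)) @[a --> F] --> (0 : \bar R).
Proof.
move=> FF eS BS BF rF; rewrite cvg0_ereal; last first.
  by move=> a; apply: limn_esup_ge0 => n; exact: outer_ge0.
split=> [h eta eta0|h].
  have [m hm] := h eta eta0; apply: filterS (BF m) => a Ba.
  apply: limn_esup_le => n; apply: le_trans (hm n).
  exact: outer_le.
apply: limsup_uniformly_exhausted => // eta eta0.
have eta2 : 0 < eta / 2 by rewrite divr_gt0.
have [m hm] := rF _ (h _ eta2); exists m; rewrite -BS.
by apply: le_lt_trans hm _; rewrite lte_fin; lra.
Qed.

Lemma limsup_normDDP :
  uniformly_exhausted (fun n => [set x : DDR R | (normDD x < n%:R%:E)%E]) <->
  limn_esup (fun n => P n [set x | (a%:E <= normDD x)%E])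
    @[a --> +oo] --> (0 : \bar R).
Proof.
have BC a : [set x : DDR R | (a%:E <= normDD x)%E] =
    ~` [set x : DDR R | (normDD x < a%:E)%E].
  by apply/seteqP; split => x /=; rewrite leNgt => /negP.
rewrite (_ : (fun a => _) = (fun a => limn_esup (fun n =>
    outer (P n) [set x | (a%:E <= normDD x)%E]))); last first.
  apply/funext => a; congr limn_esup; apply/funext => n.
  rewrite outer_measurable// BC; apply: measurableC.
  apply: open_measurable_DDR; exact: open_normDD_lt.
apply: (limsup_cvg0P (B := fun a => [set x | (a%:E <= normDD x)%E])
  (r := fun n => n%:R) _ (exhausting_normDD R)) => //.
- move=> m; near=> a => x /=; rewrite leNgt => /negP; apply: contra_not.
  move=> /lt_le_trans; apply; rewrite lee_fin; near: a.
  exact: nbhs_pinfty_ge.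
- move=> V [M [_ hM]]; exists (Num.truncn M).+1; apply: hM.
  exact: truncnS_gt.
Unshelve. all: by end_near. Qed.

Lemma right_filter_param (delta : R) : 0 < delta ->
  \forall a \near (0 : R)^'+, a <= delta.
Proof.
by move=> d0; near=> a; near: a; exact: nbhs_right_le.
Unshelve. all: by end_near. Qed.

Lemma right_filter_invS (V : set R) : (0 : R)^'+ V -> exists n : nat, V n.+1%:R^-1.
Proof.
move=> [e /= e0 h]; have [n hn] := @invS_small R (e / 2) ltac:(by rewrite divr_gt0).
have n0 : 0 < n.+1%:R^-1 :> R by rewrite invr_gt0 ltr0n.
exists n; apply: h => //=; rewrite sub0r normrN gtr0_norm//.
by apply: le_lt_trans hn _; lra.
Qed.

Lemma limsup_wDP (eps : R) : 0 < eps ->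
  uniformly_exhausted (fun n =>
    [set x : DDR R | forall t, (wD (x t) n.+1%:R^-1 < eps%:E)%E]) <->
  limn_esup (fun n => outer (P n)
      [set x : DDR R | exists t, (eps%:E <= wD (x t) delta)%E])
    @[delta --> 0^'+] --> (0 : \bar R).
Proof.
move=> eps0.
have BC a : [set x : DDR R | exists t, (eps%:E <= wD (x t) a)%E] =
    ~` [set x : DDR R | forall t, (wD (x t) a < eps%:E)%E].
  apply/seteqP; split => x /=.
    by move=> [t xt] /(_ t); rewrite ltNge xt.
  by move=> /existsNP[t /negP]; rewrite -leNgt => xt; exists t.
apply: (limsup_cvg0P
  (B := fun a => [set x : DDR R | exists t, (eps%:E <= wD (x t) a)%E])
  (r := fun n => n.+1%:R^-1) _ (exhausting_wD eps0)) => //.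
- move=> m; near=> a; rewrite BC; apply: subsetC => x h t.
  apply: le_lt_trans (h t); apply: modulus_anti; near: a.
  by apply: right_filter_param; rewrite invr_gt0 ltr0n.
- exact: right_filter_invS.
Unshelve. all: by end_near. Qed.

Lemma limsup_wDDP (eps : R) : 0 < eps ->
  uniformly_exhausted (fun n =>
    [set x : DDR R | (wDD x n.+1%:R^-1 < eps%:E)%E]) <->
  limn_esup (fun n => P n [set x | (eps%:E <= wDD x delta)%E])
    @[delta --> 0^'+] --> (0 : \bar R).
Proof.
move=> eps0.
have BC a : [set x : DDR R | (eps%:E <= wDD x a)%E] =
    ~` [set x : DDR R | (wDD x a < eps%:E)%E].
  by apply/seteqP; split => x /=; rewrite leNgt => /negP.
rewrite (_ : (fun a => _) = (fun a => limn_esup (fun n =>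
    outer (P n) [set x | (eps%:E <= wDD x a)%E]))); last first.
  apply/funext => a; congr limn_esup; apply/funext => n.
  rewrite outer_measurable// BC; apply: measurableC.
  apply: open_measurable_DDR; exact: open_wDD_lt.
apply: (limsup_cvg0P (B := fun a => [set x | (eps%:E <= wDD x a)%E])
  (r := fun n => n.+1%:R^-1) _ (exhausting_wDD eps0)) => //.
- move=> m; near=> a; rewrite BC; apply: subsetC => x /=.
  apply: le_lt_trans; apply: modulus_anti; near: a.
  by apply: right_filter_param; rewrite invr_gt0 ltr0n.
- exact: right_filter_invS.
Unshelve. all: by end_near. Qed.

End tightness.

Theorem theorem3p6 (R : realType) (P : nat -> probability (borelDDR R) R) :
  tight P <->
  [/\ limn_esup (fun n => P n [set x | (a%:E <= normDD x)%E])
        @[a --> +oo] --> (0 : \bar R),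
      (forall eps : R, 0 < eps ->
        limn_esup (fun n => outer (P n)
            [set x : DDR R | exists t, (eps%:E <= wD (x t) delta)%E])
          @[delta --> 0^'+] --> (0 : \bar R))
    & (forall eps : R, 0 < eps ->
        limn_esup (fun n => P n [set x | (eps%:E <= wDD x delta)%E])
          @[delta --> 0^'+] --> (0 : \bar R))].
Proof.
split=> [tP|[/limsup_normDDP h0 h1 h2]].
  split=> [|eps eps0|eps eps0].
  - apply/limsup_normDDP/tight_uniformly_exhausted => //.
    exact: exhausting_normDD.
  - apply/(limsup_wDP _ eps0)/tight_uniformly_exhausted => //.
    exact: exhausting_wD.
  - apply/(limsup_wDDP _ eps0)/tight_uniformly_exhausted => //.
    exact: exhausting_wDD.
apply: uniformly_exhausted_tight => // eps eps0.
  exact/(limsup_wDP _ eps0)/h1.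
exact/(limsup_wDDP _ eps0)/h2.
Qed.
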